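(* Let $X_n=(\mathbb{C}^n,\|\cdot\|)$ be a Banach lattice and let $J\subset\Lambda(m,n)$ be an index set. Then $$\boldsymbol{gl}\big(\mathcal{P}_J(X_n)\big)\le e\,\|\mathbf{Q}_{\Lambda(m,n),J}\|\,\boldsymbol{\lambda}\big(\mathcal{P}_{J^\flat}(X_n)\big).$$ Moreover, if $J\subset\mathbb{N}_0^n$ is an index set of degree $m$, then $$\boldsymbol{gl}\big(\mathcal{P}_J(X_n)\big)\le e(m+1)\max_{1\le k\le m}\|\mathbf{Q}_{\Lambda(k,n),J(k)}\|\,\max_{1\le k\le m}\boldsymbol{\lambda}\big(\mathcal{P}_{J(k)^\flat}(X_n)\big).$$
   Context: A Banach lattice $X_n=(\mathbb{C}^n,\|\cdot\|)$ is a norm on $\mathbb{C}^n$ with $\|z\|\le\|w\|$ whenever $|z_k|\le|w_k|$ for all $k$. $\Lambda(k,n)=\{\alpha\in\mathbb{N}_0^n:|\alpha|=k\}$; for $J\subset\mathbb{N}_0^n$, $J(k)=J\cap\Lambda(k,n)$; $J$ has degree $m$ if $|\alpha|\le m$ for all $\alpha\in J$ (with $m$ the maximal order). For $J\subset\Lambda(m,n)$, the reduced set $J^\flat\subset\Lambda(m-1,n)$ consists of all $\alpha\in\Lambda(m-1,n)$ such that $\alpha+e_k\in J$ for some $1\le k\le n$. $\mathcal{P}_J(X_n)$ is the space of polynomials $\sum_{\alpha\in J}c_\alpha z^\alpha$ with norm $\sup_{z\in B_{X_n}}|P(z)|$. For $I\subset J'$, $\mathbf{Q}_{J',I}:\mathcal{P}_{J'}(X_n)\to\mathcal{P}_I(X_n)$,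 $\sum_{\alpha\in J'}c_\alpha z^\alpha\mapsto\sum_{\alpha\in I}c_\alpha z^\alpha$. $\boldsymbol{\lambda}$ is the projection constant. For an operator $u:E\to F$ between finite-dimensional spaces, $\pi_1(u)$ is its 1-summing norm (least $C$ with $\sum_j\|ux_j\|\le C\sup_{\|x^*\|\le1}\sum_j|x^*(x_j)|$ for all finite families) and $\gamma_1(u)=\inf\|v\|\|w\|$ over factorizations $u=wv$ with $v:E\to\ell_1^N$, $w:\ell_1^N\to F$. The Gordon–Lewis constant $\boldsymbol{gl}(E)$ is the least $C$ with $\gamma_1(u)\le C\pi_1(u)$ for all operators $u:E\to\ell_2$. *)

(* Defs.v *)
From HB Require Import structures.
From mathcomp Require Import all_boot all_order all_algebra.
From mathcomp Require Import all_classical all_reals all_analysis.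
From mathcomp Require Import complex.
Set Implicit Arguments. Unset Strict Implicit. Unset Printing Implicit Defensive.
Import Order.TTheory GRing.Theory Num.Theory.
Local Open Scope classical_set_scope.
Local Open Scope ring_scope.

Section Defs.
Variable R : realType.
Local Notation C := R[i].

Definition cabs (z : C) : R := Normc.normc z.

(* ---------- finite-dimensional normed spaces ----------
   A space is (I -> C) for a finite index type I, with a norm p.
   Linear maps (I -> C) -> (K -> C) are given by matrices A : K -> I -> C. *)
Definition app (I K : finType) (A : K -> I -> C) (x : I -> C) : K -> C :=
  fun k => \sum_(i : I) A k i * x i.

Definition is_norm (I : finType) (p : (I -> C) -> R) : Prop :=
  [/\ forall x, p x = 0 -> forall i, x i = 0,
      forall (a : C) x, p (fun i => a * x i) = cabs a * p x &
      forall x y, p (fun i => x i + y i) <= p x + p y].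

Definition opnorm (I K : finType) (p : (I -> C) -> R) (q : (K -> C) -> R)
  (A : K -> I -> C) : R :=
  sup [set q (app A x) | x in [set x | p x <= 1]].

Definition dualnorm (I : finType) (p : (I -> C) -> R) (phi : I -> C) : R :=
  sup [set cabs (\sum_(i : I) phi i * x i) | x in [set x | p x <= 1]].

Definition weak1 (I : finType) (p : (I -> C) -> R) (xs : seq (I -> C)) : R :=
  sup [set \sum_(x <- xs) cabs (\sum_(i : I) phi i * x i)
      | phi in [set phi | dualnorm p phi <= 1]].

Definition pi1 (I K : finType) (p : (I -> C) -> R) (q : (K -> C) -> R)
  (A : K -> I -> C) : R :=
  inf [set c : R | 0 <= c /\
        forall xs : seq (I -> C), \sum_(x <- xs) q (app A x) <= c * weak1 p xs].

Definition l1norm (N : nat) (x : 'I_N -> C) : R := \sum_(j < N) cabs (x j).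
Definition l2norm (N : nat) (x : 'I_N -> C) : R :=
  Num.sqrt (\sum_(j < N) cabs (x j) ^+ 2).

Definition gamma1 (I K : finType) (p : (I -> C) -> R) (q : (K -> C) -> R)
  (A : K -> I -> C) : R :=
  inf [set t : R | exists (N : nat) (V : 'I_N -> I -> C) (W : K -> 'I_N -> C),
        (forall k i, A k i = \sum_(j < N) W k j * V j i) /\
        t = opnorm p (@l1norm N) V * opnorm (@l1norm N) q W].

(* Gordon-Lewis constant (operators into l2; their range lies in some l2^N) *)
Definition glconst (I : finType) (p : (I -> C) -> R) : R :=
  inf [set c : R | 0 <= c /\
        forall (N : nat) (A : 'I_N -> I -> C),
          gamma1 p (@l2norm N) A <= c * pi1 p (@l2norm N) A].

Definition relproj (I K : finType) (p : (I -> C) -> R) (q : (K -> C) -> R)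
  (Jm : K -> I -> C) : R :=
  inf [set s : R | exists P : I -> K -> C,
        (forall x i, app P (app Jm x) i = x i) /\ s = opnorm q p P].

Definition projconst (I : finType) (p : (I -> C) -> R) : R :=
  sup [set t : R | exists (N : nat) (q : ('I_N -> C) -> R) (Jm : 'I_N -> I -> C),
        [/\ is_norm q, (forall x, q (app Jm x) = p x) & t = relproj p q Jm]].

Definition banach_lattice (n : nat) (N : ('I_n -> C) -> R) : Prop :=
  is_norm N /\
  forall z w : 'I_n -> C, (forall k, cabs (z k) <= cabs (w k)) -> N z <= N w.

Definition Multi (n d : nat) := {ffun 'I_n -> 'I_d}.

Definition mdeg (n d : nat) (a : Multi n d) : nat := (\sum_(i < n) (a i : nat))%N.

Definition mono (n d : nat) (a : Multi n d) (z : 'I_n -> C) : C :=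
  \prod_(i < n) z i ^+ (a i : nat).

Definition Lam (n d k : nat) : {set Multi n d} := [set a | mdeg a == k].

Definition Jk (n d : nat) (J : {set Multi n d}) (k : nat) : {set Multi n d} :=
  J :&: Lam n d k.

Definition flat (n d : nat) (J : {set Multi n d}) : {set Multi n d} :=
  [set a : Multi n d | [exists b in J, exists k : 'I_n,
     ((b k : nat) == (a k).+1) && [forall j : 'I_n, (j != k) ==> ((b j : nat) == a j)]]].

Definition has_degree (n d : nat) (J : {set Multi n d}) (m : nat) : Prop :=
  (forall a, a \in J -> (mdeg a <= m)%N) /\ exists2 a, a \in J & mdeg a = m.

Definition polynorm (n d : nat) (N : ('I_n -> C) -> R) (c : Multi n d -> C) : R :=
  sup [set cabs (\sum_(a : Multi n d) c a * mono a z) | z in [set z | N z <= 1]].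

Definition PJnorm (n d : nat) (N : ('I_n -> C) -> R) (J : {set Multi n d})
  (x : {a : Multi n d | a \in J} -> C) : R :=
  sup [set cabs (\sum_(a : {a : Multi n d | a \in J}) x a * mono (val a) z)
      | z in [set z | N z <= 1]].

Definition Qnorm (n d : nat) (N : ('I_n -> C) -> R) (L J : {set Multi n d}) : R :=
  sup [set polynorm N (fun a => if a \in J then c a else 0)
      | c in [set c : Multi n d -> C |
               (forall a, a \notin L -> c a = 0) /\ polynorm N c <= 1]].

End Defs.

Arguments PJnorm {R n d} N J x.

(* Main.v *)
(* An identity of a normed space E that factors through coordinates whose sign
   changes cost at most a factor c forces gl(E) <= c: for u : E -> l_2 let the
   k-th coordinate be a_k (x) b_k and factor u through l_1 by
   x |-> (a_k(x) ||u b_k||)_k; its norm is controlled by applying the definition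
   of pi_1(u) to the vectors a_k(x) b_k.

   For the k-homogeneous part of P in P_J the coordinates are
   (1/k) d_i P (z_j), with (z_j) a fine net of the unit ball of X_n: by
   polarization they define, for each j, a functional of norm at most e ||P|| on
   X_n, and the lattice property of X_n absorbs sign changes.  As d_i P lies in
   P_{J^flat}, which is nearly complemented in l_infinity up to
   lambda(P_{J^flat}), one recovers P by Euler's identity
   k P = sum_i z_i d_i P, followed by Q_J. *)

(* The crux is that the projection onto P_{J^flat} acts on the net index j and multiplication by z_i
   on the index i. For fixed z, summing z_i times the projection of the i-th signed family is
   therefore the projection of one function of j, whose value at j is (1/k) times the derivative at
   z_j in the direction (z_i t(j,i))_i. This direction has the same moduli as z, hence stays in the
   ball. So one projection constant suffices, with no factor n. The signed sum is only known to be
   k-homogeneous, which is why Q_J must follow.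

   The net costs a factor above 1 and infima over projections are only approached, so the argument
   runs with every number above the projection constant and ends with a limit.

   Since [sup] and [inf] default to 0 on unbounded or empty sets, each norm estimate rests on a
   finiteness proof: coercivity, a uniform bound on projections, an admissible constant for [pi1].

   For J of degree m the m+1 homogeneous parts are treated separately and their costs add up. Degree
   0 has no derivative; it costs 1, which the common bound absorbs. *)
Require Import Defs.
From HB Require Import structures.
From mathcomp Require Import all_boot all_order all_algebra.
From mathcomp Require Import all_classical all_reals all_analysis.
From mathcomp Require Import cyclic separable cyclotomic complex ring lra.
Set Implicit Arguments. Unset Strict Implicit. Unset Printing Implicit Defensive.
Import Order.TTheory GRing.Theory Num.Theory.
Local Open Scope ring_scope.

(** * Complex modulus and roots of unity *)

Section ComplexModulus.
Variable R : realType.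
Local Notation C := R[i].
Local Open Scope complex_scope.
Implicit Types z w : C.

Lemma normc_cabs z : `|z| = (cabs z)%:C.
Proof. by rewrite normc_def /cabs; case: z. Qed.

Lemma cabs_ge0 z : 0 <= cabs z.
Proof. by rewrite -ler0c -normc_cabs normr_ge0. Qed.

Lemma cabs0 : cabs (0 : C) = 0.
Proof. exact: Normc.normc0. Qed.

Lemma cabs1 : cabs (1 : C) = 1.
Proof. exact: Normc.normc1. Qed.

Lemma cabs_eq0 z : cabs z = 0 -> z = 0.
Proof. exact: Normc.eq0_normc. Qed.

Lemma cabsM z w : cabs (z * w) = cabs z * cabs w.
Proof. exact: Normc.normcM. Qed.

Lemma cabsV z : cabs z^-1 = (cabs z)^-1.
Proof. exact: Normc.normcV. Qed.

Lemma cabsD z w : cabs (z + w) <= cabs z + cabs w.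
Proof. by rewrite -lecR rmorphD /= -!normc_cabs ler_normD. Qed.

Lemma cabsN z : cabs (- z) = cabs z.
Proof. by apply: complexI; rewrite -!normc_cabs normrN. Qed.

Lemma cabs_sum (I : Type) (r : seq I) (P : pred I) (F : I -> C) :
  cabs (\sum_(i <- r | P i) F i) <= \sum_(i <- r | P i) cabs (F i).
Proof.
elim/big_rec2: _ => [|i y z _ le_zy]; first by rewrite cabs0.
by apply: le_trans (cabsD _ _) _; rewrite lerD2l.
Qed.

Lemma cabs_prod (I : Type) (r : seq I) (P : pred I) (F : I -> C) :
  cabs (\prod_(i <- r | P i) F i) = \prod_(i <- r | P i) cabs (F i).
Proof. by apply: (big_morph _ cabsM cabs1). Qed.

Lemma cabsX z n : cabs (z ^+ n) = cabs z ^+ n.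
Proof. by apply: complexI; rewrite rmorphXn /= -!normc_cabs normrX. Qed.

Lemma cabs_real (r : R) : 0 <= r -> cabs r%:C = r.
Proof. by move=> r0; apply: complexI; rewrite -normc_cabs ger0_norm ?ler0c. Qed.

Lemma cabs_nat n : cabs (n%:R : C) = n%:R.
Proof. by rewrite -[X in cabs X](rmorph_nat (real_complex R)) cabs_real ?ler0n. Qed.

Lemma cabs_phase z : exists2 t : C, cabs t = 1 & t * z = (cabs z)%:C.
Proof.
have [->|z0] := eqVneq z 0; first by exists 1; rewrite ?cabs1 // mul1r cabs0.
have c0 : cabs z != 0 by apply: contra_neq z0; exact: cabs_eq0.
exists ((cabs z)%:C / z); last by rewrite divfK.
by rewrite cabsM cabsV cabs_real ?cabs_ge0 // divff.
Qed.

Lemma Re_le_cabs z : complex.Re z <= cabs z.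
Proof.
rewrite -lecR -normc_cabs; apply: le_trans (normc_ge_Re z).
by rewrite lecR ler_norm.
Qed.

Lemma ReD z w : complex.Re (z + w) = complex.Re z + complex.Re w.
Proof. by case: z; case: w. Qed.

(** ['X^n - 1] splits and is separable in characteristic 0, so it has n distinct roots. Roots of
    unity let finite averages replace the circle integrals of Cauchy's formula. *)
Lemma exists_prim_root n : (0 < n)%N -> exists w : C, n.-primitive_root w.
Proof.
case: n => // n _; pose p : {poly C} := 'X^(n.+1) - 1.
have [r Dp] := closed_field_poly_normal p.
rewrite (monicP _) ?monicXnsubC // scale1r in Dp.
have rn : all n.+1.-unity_root r by apply/allP => z; rewrite -root_prod_XsubC -Dp.
have szr : (n.+1 <= size r)%N.
  by rewrite -ltnS -(size_prod_XsubC r id) -Dp size_XnsubC.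
have ur : uniq r.
  by rewrite -separable_prod_XsubC -Dp separable_Xn_sub_1 // pnatr_eq0.
by have /hasP[z _ pz] := has_prim_root (ltn0Sn n) rn ur szr; exists z.
Qed.

End ComplexModulus.

(** * Seminorms and the norms of operators *)

Section Seminorms.
Variable R : realType.
Local Notation C := R[i].
Local Open Scope complex_scope.
Local Open Scope classical_set_scope.

Lemma sup_ge0 (S : set R) : (forall x, S x -> 0 <= x) -> 0 <= sup S.
Proof.
move=> S0; case: (pselect (has_sup S)) => [hS|/sup_out -> //].
have [[x Sx] _] := hS; apply: le_trans (S0 _ Sx) _.
by apply: ub_le_sup => //; case: hS.
Qed.

Lemma inf_ge0 (S : set R) : (forall x, S x -> 0 <= x) -> 0 <= inf S.
Proof.
move=> S0; case: (pselect (S !=set0)) => [hS|/set0P/negP]; first exact: lb_le_inf.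
by rewrite negbK => /eqP ->; rewrite inf0.
Qed.

(** Closes arguments that only reach numbers strictly above an infimum or a projection constant. The
    slack [e / (c + 1)] also covers c = 0. *)
Lemma le_mul_of_gt (g c L : R) : 0 <= c -> (forall l, L < l -> g <= c * l) -> g <= c * L.
Proof.
move=> c0 H; apply/ler_addgt0Pr => e e0.
have d0 : 0 < e / (c + 1) by rewrite divr_gt0 // ltr_wpDl.
have := H (L + e / (c + 1)); rewrite ltrDl => /(_ d0) /le_trans; apply.
rewrite mulrDr lerD2l mulrCA -[leRHS]mulr1 ler_wpM2l ?(ltW e0) //.
by rewrite ler_pdivrMr ?mul1r ?lerDl // ltr_wpDl.
Qed.

Lemma le_mul_inf (S : set R) (g c : R) : S !=set0 -> (forall x, S x -> 0 <= x) ->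
  0 <= c -> (forall x, S x -> g <= c * x) -> g <= c * inf S.
Proof.
move=> S0 Sge0 c0 H; have hl : has_inf S by split=> //; exists 0.
apply: le_mul_of_gt => // l; rewrite -subr_gt0 => /(inf_adherent)/(_ hl)[x Sx].
by rewrite subrKC => /ltW xl; apply: le_trans (H _ Sx) _; rewrite ler_wpM2l.
Qed.

Definition delta (I : finType) (i j : I) : C := (j == i)%:R.

Definition seminorm (I : finType) (p : (I -> C) -> R) : Prop :=
  (forall (a : C) x, p (fun i => a * x i) = cabs a * p x) /\
  (forall x y, p (fun i => x i + y i) <= p x + p y).

(** A quantitative form of definiteness. It makes the suprema over the unit ball of [p] finite, so
    that they do not collapse to the default 0, and it is obtained without compactness. *)
Definition coercive (I : finType) (p : (I -> C) -> R) : Prop :=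
  exists2 K, 0 <= K & forall x i, cabs (x i) <= K * p x.

Section OneSpace.
Variables (I : finType) (p : (I -> C) -> R).

Lemma is_norm_seminorm : is_norm p -> seminorm p.
Proof. by case=> _ pZ pD; split. Qed.

Hypothesis hp : seminorm p.

Lemma seminormZ (a : C) x : p (fun i => a * x i) = cabs a * p x.
Proof. by case: hp. Qed.

Lemma seminormD x y : p (fun i => x i + y i) <= p x + p y.
Proof. by case: hp. Qed.

Lemma seminorm0 : p (fun _ => 0) = 0.
Proof.
by have := seminormZ 0 (fun _ => 0); rewrite cabs0 !mul0r.
Qed.

Lemma seminormN x : p (fun i => - x i) = p x.
Proof.
have := seminormZ (-1) x; rewrite cabsN cabs1 mul1r => <-.
by congr p; apply/funext => i; rewrite mulN1r.
Qed.

Lemma seminorm_ge0 x : 0 <= p x.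
Proof.
have := seminormD x (fun i => - x i); rewrite seminormN.
rewrite (_ : (fun i => _) = (fun _ => 0)) ?seminorm0; first by lra.
by apply/funext => i; rewrite subrr.
Qed.

Lemma seminorm_sum (T : Type) (r : seq T) (F : T -> I -> C) :
  p (fun i => \sum_(k <- r) F k i) <= \sum_(k <- r) p (F k).
Proof.
elim: r => [|k r IH].
  by under eq_fun do rewrite big_nil; rewrite big_nil seminorm0.
under eq_fun do rewrite big_cons; rewrite big_cons.
by apply: le_trans (seminormD _ _) _; rewrite lerD2l.
Qed.

Lemma delta_sum (x : I -> C) i : x i = \sum_j x j * delta j i.
Proof.
rewrite (bigD1 i) //= big1 ?addr0 /delta ?eqxx ?mulr1 // => j ji.
by rewrite eq_sym (negbTE ji) mulr0.
Qed.

Lemma seminorm_le_delta x : p x <= \sum_i cabs (x i) * p (delta i).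
Proof.
rewrite [in leLHS](_ : x = fun i => \sum_j x j * delta j i); last first.
  by apply/funext => i; exact: delta_sum.
apply: le_trans (seminorm_sum _ (fun j i => x j * delta j i)) _.
by apply: ler_sum => j _; rewrite seminormZ.
Qed.

Lemma seminorm_le_cabs : exists2 K, 0 <= K &
  forall x s, (forall i, cabs (x i) <= s) -> p x <= K * s.
Proof.
exists (\sum_i p (delta i)) => [|x s xs]; first by apply: sumr_ge0 => i _; exact: seminorm_ge0.
apply: le_trans (seminorm_le_delta x) _; rewrite mulr_suml; apply: ler_sum => i _.
by rewrite mulrC ler_wpM2l ?seminorm_ge0.
Qed.

(** The homogeneity argument shared by operator norms, dual norms and [Qnorm]; [D] is the unit ball
    or its trace on a subspace. The crude constant [K] makes the supremum genuine, and the last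
    hypothesis settles the case [p x = 0], where rescaling is impossible. *)
Lemma le_sup_ball (f : (I -> C) -> R) (D : set (I -> C)) (K : R) (x : I -> C) :
  (forall y, D y -> f y <= K) ->
  (forall t : R, 0 <= t -> t * p x <= 1 -> D (fun i => t%:C * x i)) ->
  (forall t : R, 0 <= t -> f (fun i => t%:C * x i) = t * f x) ->
  f x <= K * p x -> f x <= sup [set f y | y in D] * p x.
Proof.
move=> fD DZ fZ fK; have := seminorm_ge0 x; rewrite le_eqVlt => /orP[/eqP p0|p0].
  by move: fK; rewrite -p0 !mulr0.
rewrite -ler_pdivrMr // mulrC -fZ ?invr_ge0 ?(ltW p0) //.
apply: ub_le_sup; first by exists K => _ [y Dy <-]; exact: fD.
by exists (fun i => (p x)^-1%:C * x i) => //; apply: DZ; rewrite ?invr_ge0 ?(ltW p0) // mulVf ?gt_eqF.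
Qed.

End OneSpace.

Lemma appZ (I K : finType) (A : K -> I -> C) (a : C) x :
  app A (fun i => a * x i) = fun k => a * app A x k.
Proof. by apply/funext => k; rewrite /app mulr_sumr; apply: eq_bigr => i _; rewrite mulrCA. Qed.

Lemma appD (I K : finType) (A : K -> I -> C) x y :
  app A (fun i => x i + y i) = fun k => app A x k + app A y k.
Proof. by apply/funext => k; rewrite /app -big_split; apply: eq_bigr => i _; rewrite mulrDr. Qed.

Lemma app_delta (I K : finType) (A : K -> I -> C) i : app A (delta i) = A ^~ i.
Proof.
apply/funext => k; rewrite /app (bigD1 i) //= big1 ?addr0 /delta ?eqxx ?mulr1 // => j ji.
by rewrite (negbTE ji) mulr0.
Qed.

Lemma seminorm_app (I K : finType) (q : (K -> C) -> R) (A : K -> I -> C) :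
  seminorm q -> seminorm (fun x => q (app A x)).
Proof.
move=> hq; split=> [a x|x y]; first by rewrite appZ seminormZ.
by rewrite appD seminormD.
Qed.

Section TwoSpaces.
Variables (I K : finType) (p : (I -> C) -> R) (q : (K -> C) -> R).
Hypotheses (hp : seminorm p) (cp : coercive p) (hq : seminorm q).

Lemma seminorm_dominated (r : (I -> C) -> R) : seminorm r ->
  exists2 M, 0 <= M & forall x, r x <= M * p x.
Proof.
move=> hr; have [M0 M00 H0] := seminorm_le_cabs hr; have [L L0 H] := cp.
exists (M0 * L) => [|x]; first exact: mulr_ge0.
by rewrite -mulrA; apply: H0.
Qed.

Lemma opnorm_bound (A : K -> I -> C) x : q (app A x) <= opnorm p q A * p x.
Proof.
have [M M0 H] := seminorm_dominated (seminorm_app A hq).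
apply: (le_sup_ball hp (f := fun x => q (app A x)) (K := M)) => //.
- by move=> y /= y1; apply: le_trans (H y) _; rewrite ler_piMr.
- by move=> t t0; rewrite /= (seminormZ hp) cabs_real.
- by move=> t t0; rewrite appZ (seminormZ hq) cabs_real.
Qed.

Lemma opnorm_le (A : K -> I -> C) (s : R) : 0 <= s ->
  (forall x, q (app A x) <= s * p x) -> opnorm p q A <= s.
Proof.
move=> s0 H; apply: ge_sup.
  by exists (q (app A (fun _ => 0))), (fun _ => 0); rewrite //= (seminorm0 hp) ler01.
by move=> _ [x /= x1 <-]; apply: le_trans (H x) _; rewrite ler_piMr.
Qed.

Lemma opnorm_ge0 (A : K -> I -> C) : 0 <= opnorm p q A.
Proof. by apply: sup_ge0 => _ [x _ <-]; exact: seminorm_ge0. Qed.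

End TwoSpaces.

Section Duality.
Variables (I : finType) (p : (I -> C) -> R).
Hypotheses (hp : seminorm p) (cp : coercive p).

Lemma seminorm_functional (phi : I -> C) : seminorm (fun x => cabs (\sum_i phi i * x i)).
Proof.
split=> [a x|x y].
  by rewrite -cabsM mulr_sumr; congr cabs; apply: eq_bigr => i _; rewrite mulrCA.
apply: le_trans (cabsD _ _); rewrite -big_split /=.
by under eq_bigr do rewrite mulrDr.
Qed.

Lemma dualnorm_bound (phi : I -> C) x : cabs (\sum_i phi i * x i) <= dualnorm p phi * p x.
Proof.
have [M M0 H] := seminorm_dominated cp (seminorm_functional phi).
apply: (le_sup_ball hp (f := fun x => cabs (\sum_i phi i * x i)) (K := M)) => //.
- by move=> y /= y1; apply: le_trans (H y) _; rewrite ler_piMr.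
- by move=> t t0; rewrite /= (seminormZ hp) cabs_real.
- by move=> t t0; rewrite (seminormZ (seminorm_functional phi)) cabs_real.
Qed.

Lemma dualnorm_le1P (phi : I -> C) :
  (dualnorm p phi <= 1) <-> forall x, cabs (\sum_i phi i * x i) <= p x.
Proof.
split=> [le1 x|H].
  apply: le_trans (dualnorm_bound phi x) _.
  by rewrite -[leRHS]mul1r ler_wpM2r ?seminorm_ge0.
apply: ge_sup.
  by exists (cabs (\sum_i phi i * 0)), (fun _ => 0); rewrite //= (seminorm0 hp) ler01.
by move=> _ [x /= x1 <-]; apply: le_trans (H x) _.
Qed.

Lemma weak1_ge (xs : seq (I -> C)) (phi : I -> C) :
  (forall x, cabs (\sum_i phi i * x i) <= p x) ->
  \sum_(x <- xs) cabs (\sum_i phi i * x i) <= weak1 p xs.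
Proof.
move=> /dualnorm_le1P le1; apply: ub_le_sup; last by exists phi.
exists (\sum_(x <- xs) p x) => _ [psi /= /dualnorm_le1P H <-].
by apply: ler_sum => x _.
Qed.

Lemma weak1_le (xs : seq (I -> C)) (s : R) :
  (forall phi : I -> C, (forall x, cabs (\sum_i phi i * x i) <= p x) ->
     \sum_(x <- xs) cabs (\sum_i phi i * x i) <= s) -> weak1 p xs <= s.
Proof.
move=> H; apply: ge_sup; last by move=> _ [phi /= /dualnorm_le1P h <-]; exact: H.
exists (\sum_(x <- xs) cabs (\sum_i (fun _ => 0) i * x i)), (fun _ => 0) => //=.
apply/dualnorm_le1P => x; rewrite big1 ?cabs0 ?(seminorm_ge0 hp) // => i _.
by rewrite mul0r.
Qed.

(** Each coordinate functional, divided by [L + 1], lies in the dual ball, so [weak1] controls the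
    sums of coordinates. This provides an element of the set whose infimum is [pi1]; otherwise the
    infimum could be the default 0. *)
Lemma pi1_finite (K : finType) (q : (K -> C) -> R) (A : K -> I -> C) : seminorm q ->
  exists c, 0 <= c /\ forall xs : seq (I -> C), \sum_(x <- xs) q (app A x) <= c * weak1 p xs.
Proof.
move=> hq; have [L L0 HL] := cp; have L1 : 0 < L + 1 by rewrite ltr_wpDl.
have coord xs i : \sum_(x <- xs) cabs (x i) <= (L + 1) * weak1 p xs.
  have phiE x : \sum_j (L + 1)^-1%:C * delta i j * x j = (L + 1)^-1%:C * x i.
    rewrite (bigD1 i) //= big1 ?addr0 /delta ?eqxx ?mulr1 // => j ji.
    by rewrite (negbTE ji) mulr0 mul0r.
  have inv0 : 0 <= (L + 1)^-1 by rewrite invr_ge0 ltW.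
  have /(weak1_ge xs) : forall x, cabs (\sum_j (L + 1)^-1%:C * delta i j * x j) <= p x.
    move=> x; rewrite phiE cabsM cabs_real // ler_pdivrMl //.
    apply: le_trans (HL x i) _; rewrite ler_wpM2r ?seminorm_ge0 //; lra.
  under eq_bigr do rewrite phiE cabsM cabs_real //.
  by rewrite -mulr_sumr ler_pdivrMl.
exists ((\sum_i q (app A (delta i))) * (L + 1)); split.
  apply: mulr_ge0; last exact: ltW.
  by apply: sumr_ge0 => i _; exact: seminorm_ge0.
move=> xs; rewrite -mulrA mulr_suml.
apply: le_trans (ler_sum _ (fun x _ => seminorm_le_delta (seminorm_app A hq) x)) _.
rewrite exchange_big /=; apply: ler_sum => i _.
by rewrite -mulr_suml mulrC ler_wpM2l ?seminorm_ge0.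
Qed.

End Duality.

Lemma l1norm_seminorm N : seminorm (@l1norm R N).
Proof.
split=> [a x|x y]; rewrite /l1norm.
  by rewrite mulr_sumr; apply: eq_bigr => i _; rewrite cabsM.
by rewrite -big_split; apply: ler_sum => i _; exact: cabsD.
Qed.

Lemma l2norm_sqr N x : @l2norm R N x ^+ 2 = \sum_j cabs (x j) ^+ 2.
Proof. by rewrite sqr_sqrtr // sumr_ge0 // => j _; rewrite sqr_ge0. Qed.

Lemma l2norm_eq0 N (x : 'I_N -> C) j : l2norm x = 0 -> x j = 0.
Proof.
move=> x0; have := l2norm_sqr x; rewrite x0 expr0n /= => /esym/eqP.
rewrite psumr_eq0 => [/allP/(_ j (mem_index_enum j))|i _]; last by rewrite sqr_ge0.
by rewrite sqrf_eq0 => /eqP /cabs_eq0.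
Qed.

Lemma l2norm_seminorm N : seminorm (@l2norm R N).
Proof.
have l20 x : 0 <= @l2norm R N x by exact: sqrtr_ge0.
split=> [a x|x y].
  rewrite /l2norm; under eq_bigr do rewrite cabsM exprMn.
  by rewrite -mulr_sumr sqrtrM ?sqr_ge0 // sqrtr_sqr ger0_norm ?cabs_ge0.
have [x0|x0] := eqVneq (l2norm x) 0.
  rewrite x0 add0r (_ : (fun i => _) = y) //; apply/funext => i.
  by rewrite (l2norm_eq0 i x0) add0r.
have [y0|y0] := eqVneq (l2norm y) 0.
  rewrite y0 addr0 (_ : (fun i => _) = x) //; apply/funext => i.
  by rewrite (l2norm_eq0 i y0) addr0.
have {}x0 : 0 < l2norm x by rewrite lt_def x0 l20.
have {}y0 : 0 < l2norm y by rewrite lt_def y0 l20.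
rewrite -ler_sqr ?nnegrE ?addr_ge0 ?l20 // l2norm_sqr.
set X := l2norm x; set Y := l2norm y.
(* Convexity of the square, with weights X / (X + Y) and Y / (X + Y). *)
have -> : (X + Y) ^+ 2 = (X + Y) / X * \sum_j cabs (x j) ^+ 2 + (X + Y) / Y * \sum_j cabs (y j) ^+ 2.
  rewrite -!l2norm_sqr -/X -/Y; field.
  by rewrite ?gt_eqF.
rewrite !mulr_sumr -big_split; apply: ler_sum => j _ /=.
apply: (@le_trans _ _ ((cabs (x j) + cabs (y j)) ^+ 2)).
  by rewrite ler_sqr ?nnegrE ?addr_ge0 ?cabs_ge0 // cabsD.
move: (cabs (x j)) (cabs (y j)) => a b; rewrite -subr_ge0.
have -> : (X + Y) / X * a ^+ 2 + (X + Y) / Y * b ^+ 2 - (a + b) ^+ 2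
   = (a * Y - b * X) ^+ 2 / (X * Y) by field; rewrite ?gt_eqF.
by rewrite divr_ge0 ?sqr_ge0 // mulr_ge0 // ltW.
Qed.

End Seminorms.

Arguments delta {R I} i j.

(** * Gordon-Lewis constants from unconditional factorizations *)

Section UnconditionalFactorization.
Variable R : realType.
Local Notation C := R[i].
Local Open Scope complex_scope.
Local Open Scope classical_set_scope.

(** Stated for a map [T] rather than for the identity, so that homogeneous parts can be factored one
    by one and then added. Signs are complex numbers of modulus 1. *)
Definition unc_fact (I L : finType) (p : (I -> C) -> R) (q : (L -> C) -> R)
    (T : (I -> C) -> (L -> C)) (c : R) : Prop :=
  exists (K : finType) (A : K -> I -> C) (B : L -> K -> C),
    (forall x i, app B (app A x) i = T x i) /\
    (forall t : K -> C, (forall k, cabs (t k) = 1) ->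
       forall x, q (app B (fun k => t k * app A x k)) <= c * p x).

(** The two systems of coordinates are put side by side; a choice of signs on the union restricts to
    each of them. *)
Lemma unc_factD (I L : finType) (p : (I -> C) -> R) (q : (L -> C) -> R)
    (S T U : (I -> C) -> (L -> C)) (c d : R) : seminorm q ->
  unc_fact p q S c -> unc_fact p q T d ->
  (forall x i, U x i = S x i + T x i) -> unc_fact p q U (c + d).
Proof.
move=> hq [K1 [A1 [B1 [E1 H1]]]] [K2 [A2 [B2 [E2 H2]]]] UE.
exists (K1 + K2)%type, (fun k => match k with inl a => A1 a | inr b => A2 b end),
  (fun i k => match k with inl a => B1 i a | inr b => B2 i b end).
split=> [x i|t t1 x].
  by rewrite UE -E1 -E2 /app big_sumType.
rewrite mulrDl; apply: le_trans (lerD (H1 (t \o inl) _ x) (H2 (t \o inr) _ x)).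
- by apply: le_trans (seminormD hq _ _); rewrite /app; under eq_fun do rewrite big_sumType.
- by move=> k; exact: t1.
- by move=> k; exact: t1.
Qed.

Lemma unc_fact_le (I L : finType) (p : (I -> C) -> R) (q : (L -> C) -> R)
    (T U : (I -> C) -> (L -> C)) (c d : R) : (forall x, 0 <= p x) ->
  unc_fact p q T c -> (forall x i, U x i = T x i) -> c <= d -> unc_fact p q U d.
Proof.
move=> p0 [K [A [B [E H]]]] UE cd; exists K, A, B; split=> [x i|t t1 x].
  by rewrite UE.
by apply: le_trans (H t t1 x) _; rewrite ler_wpM2r.
Qed.

Lemma unc_fact_sum (I L : finType) (p : (I -> C) -> R) (q : (L -> C) -> R)
    (T : nat -> (I -> C) -> (L -> C)) (c : nat -> R) n : seminorm p -> seminorm q ->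
  (forall k, (k < n)%N -> unc_fact p q (T k) (c k)) ->
  unc_fact p q (fun x i => \sum_(k < n) T k x i) (\sum_(k < n) c k).
Proof.
move=> hp hq; elim: n => [|n IH] H.
  exists 'I_0, (fun _ _ => 0), (fun _ _ => 0); split=> [x i|t t1 x].
    by rewrite /app !big_ord0.
  rewrite big_ord0 mul0r (_ : app _ _ = fun _ => 0) ?(seminorm0 hq) //.
  by apply/funext => i; rewrite /app big_ord0.
rewrite big_ord_recr; apply: (unc_factD hq (IH _) (H n _)) => //.
  by move=> k kn; apply: H; exact: ltnW.
by move=> x i; rewrite big_ord_recr.
Qed.

Section GordonLewis.
Variables (I : finType) (p : (I -> C) -> R) (c : R).
Hypotheses (hp : seminorm p) (cp : coercive p) (c0 : 0 <= c).

Lemma gamma1_le (N : nat) (A : 'I_N -> I -> C) (a : R) : 0 <= a ->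
  unc_fact p p id c ->
  (forall xs : seq (I -> C), \sum_(x <- xs) l2norm (app A x) <= a * weak1 p xs) ->
  gamma1 p (@l2norm R N) A <= c * a.
Proof.
move=> a0 [K [U [B [BU HB]]]] Ha.
have h2 := @l2norm_seminorm R N.
pose b (k : K) := app A (B ^~ k); pose beta k : C := (l2norm (b k))%:C.
have b0 k : 0 <= l2norm (b k) by exact: seminorm_ge0.
pose e (j : 'I_#|K|) : K := enum_val j.
have sumK (M : nmodType) (F : K -> M) : \sum_j F (e j) = \sum_k F k.
  by rewrite -(big_enum_val (A := K)); apply: eq_bigl.
pose V j i := beta (e j) * U (e j) i.
(* Where [b k] vanishes, the convention 0^-1 = 0 gives a zero column, and [Wb] still holds because
   both sides are 0. *)
pose W l j := (beta (e j))^-1 * b (e j) l.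
have Wb k l : (beta k)^-1 * b k l * beta k = b k l.
  have [bk|bk] := eqVneq (beta k) 0; last by rewrite mulrAC mulVf ?mul1r.
  rewrite bk mulr0; apply/esym/(l2norm_eq0 l).
  by case: bk.
have WV l i : A l i = \sum_(j < #|K|) W l j * V j i.
  rewrite /W /V (sumK _ (fun k => (beta k)^-1 * b k l * (beta k * U k i))) /=.
  under eq_bigr do rewrite mulrA Wb /b /app mulr_suml.
  rewrite exchange_big /=.
  rewrite [LHS](delta_sum (A l) i); apply: eq_bigr => i' _.
  under eq_bigr do rewrite -mulrA; rewrite -mulr_sumr; congr (_ * _).
  have := BU (delta i) i'; rewrite app_delta /app => ->.
  by rewrite /delta eq_sym.
apply: le_trans (_ : opnorm p (@l1norm R _) V * opnorm (@l1norm R _) (@l2norm R N) W <= _).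
  apply: ge_inf; last by exists #|K|, V, W.
  exists 0 => _ [n' [V' [W' [_ ->]]]].
  by apply: mulr_ge0; apply: opnorm_ge0; [exact: l1norm_seminorm|exact: l2norm_seminorm].
rewrite -[leRHS]mulr1; apply: ler_pM.
- by apply: opnorm_ge0; exact: l1norm_seminorm.
- exact: opnorm_ge0.
- apply: opnorm_le => //; first exact: mulr_ge0.
  move=> x; pose y k i := app U x k * B i k.
  have -> : l1norm (app V x) = \sum_(z <- [seq y k | k <- enum K]) l2norm (app A z).
    rewrite big_map big_enum /l1norm /= (sumK _ (fun k => cabs (\sum_i beta k * U k i * x i))) /=.
    apply: eq_bigr => k _; rewrite /y appZ (seminormZ h2).
    by under eq_bigr do rewrite -mulrA; rewrite -mulr_sumr cabsM cabs_real // mulrC.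
  apply: le_trans (Ha _) _; rewrite [c * a]mulrC -mulrA ler_wpM2l //.
  apply: weak1_le => // phi Hphi; rewrite big_map big_enum /=.
  (* The signs rotate every phi(y_k) onto its modulus, so the sum to be bounded is phi evaluated at
     a single sign-changed vector, to which [HB] applies. *)
  have /choice [t Ht] : forall k, exists t : C, cabs t = 1 /\
      t * (\sum_i phi i * y k i) = (cabs (\sum_i phi i * y k i))%:C.
    by move=> k; have [t] := cabs_phase (\sum_i phi i * y k i); exists t.
  have tH k : cabs (t k) = 1 by case: (Ht k).
  apply: le_trans (HB t tH x); apply: le_trans (Hphi _).
  rewrite (_ : \sum_i _ = (\sum_k cabs (\sum_i phi i * y k i))%:C); last first.
    rewrite rmorph_sum /=; under [RHS]eq_bigr => k _ do rewrite -(proj2 (Ht k)) mulr_sumr.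
    rewrite exchange_big /=; apply: eq_bigr => i _; rewrite /app mulr_sumr.
    by apply: eq_bigr => k _; rewrite /y /app; ring.
  rewrite cabs_real; last by apply: sumr_ge0 => k _; exact: cabs_ge0.
  by rewrite (eq_bigl xpredT).
(* The columns of [W] are normalized, or zero, hence [W] is a contraction on l_1. *)
- apply: opnorm_le => //; first exact: l1norm_seminorm.
  move=> y; rewrite mul1r.
apply: le_trans (seminorm_sum h2 _ (fun j l => W l j * y j)) _.
apply: ler_sum => j _; rewrite (_ : (fun l => _) = fun l => (y j * (beta (e j))^-1) * b (e j) l).
  rewrite (seminormZ h2) cabsM -mulrA -[leRHS]mulr1 ler_wpM2l ?cabs_ge0 //.
  rewrite cabsV cabs_real //; have [->|nz] := eqVneq (l2norm (b (e j))) 0.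
    by rewrite mulr0.
  by rewrite mulVf.
by apply/funext => l; rewrite /W; ring.
Qed.

Lemma glconst_le : unc_fact p p id c -> glconst p <= c.
Proof.
move=> hu; apply: ge_inf; first by exists 0 => x [].
split=> // N A; apply: le_mul_inf => //.
- exact: (pi1_finite hp cp A (@l2norm_seminorm R N)).
- by move=> x [].
- by move=> x [x0 Hx]; exact: gamma1_le.
Qed.

End GordonLewis.
End UnconditionalFactorization.

(** * Hahn-Banach extension in finite dimension *)

Section HahnBanach.
Variable R : realType.
Local Notation C := R[i].
Local Open Scope complex_scope.
Local Open Scope classical_set_scope.
Variables (L : finType) (q : (L -> C) -> R).
Hypothesis hq : seminorm q.

(** A real functional on a subspace, dominated by [q], given by its graph. Single-valuedness follows
    from domination: two values at the same vector differ by at most [q] at 0. *)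
Definition real_linear_graph (G : (L -> C) -> R -> Prop) : Prop :=
  [/\ forall v w a b, G v a -> G w b -> G (fun l => v l + w l) (a + b),
      forall (t : R) v a, G v a -> G (fun l => t%:C * v l) (t * a) &
      forall v a, G v a -> a <= q v].

Lemma seminormZr (t : R) v : 0 <= t -> q (fun l => t%:C * v l) = t * q v.
Proof. by move=> t0; rewrite (seminormZ hq) cabs_real. Qed.

(** The value at [u] may be any number between the lower bounds [a - q (v - u)] and the upper bounds
    [q (w + u) - b]; subadditivity ([Sub]) puts the former below the latter, and the supremum of the
    lower bounds is taken. *)
Lemma graph_extend1 G (u : L -> C) : real_linear_graph G -> G (fun _ => 0) 0 ->
  exists G' : (L -> C) -> R -> Prop, [/\ real_linear_graph G',
    forall v a, G v a -> G' v a & exists a, G' u a].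
Proof.
move=> [GD GZ Gq] G0.
pose S := [set r | exists v a, G v a /\ r = a - q (fun l => v l - u l)].
have Sub v a w b : G v a -> G w b ->
    a - q (fun l => v l - u l) <= q (fun l => w l + u l) - b.
  move=> Gv Gw; have := Gq _ _ (GD _ _ _ _ Gv Gw).
  have := seminormD hq (fun l => v l - u l) (fun l => w l + u l).
  rewrite (_ : (fun i => _) = fun l => v l + w l); first by lra.
  by apply/funext => l; ring.
pose al := sup S.
have al_ge v a : G v a -> a - q (fun l => v l - u l) <= al.
  move=> Gv; apply: ub_le_sup; last by exists v, a.
  exists (q (fun l => 0 + u l) - 0) => _ [w [b [Gw ->]]]; exact: Sub.
have al_le v a : G v a -> al <= q (fun l => v l + u l) - a.
  move=> Gv; apply: ge_sup; first by exists (0 - q (fun l => 0 - u l)), (fun _ => 0), 0.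
  move=> _ [w [b [Gw ->]]]; exact: Sub.
exists (fun w b => exists v a (s : R), [/\ G v a, w = (fun l => v l + s%:C * u l) & b = a + s * al]).
split; last 2 first.
- move=> v a Gv; exists v, a, 0; split=> //; last by rewrite mul0r addr0.
  by apply/funext => l; rewrite mul0r addr0.
- exists al, (fun _ => 0), 0, 1; split=> //; last by rewrite mul1r add0r.
  by apply/funext => l; rewrite mul1r add0r.
split.
- move=> _ _ _ _ [v [a [s [Gv -> ->]]]] [w [b [t [Gw -> ->]]]].
  exists (fun l => v l + w l), (a + b), (s + t); split; [exact: GD| |by ring].
  by apply/funext => l; rewrite rmorphD /=; ring.
- move=> t _ _ [v [a [s [Gv -> ->]]]].
  exists (fun l => t%:C * v l), (t * a), (t * s); split; [exact: GZ| |by ring].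
  by apply/funext => l; rewrite rmorphM /=; ring.
(* Dividing by |s| reduces domination to [al_le] when s is positive and to [al_ge] when s is
   negative. *)
- move=> _ _ [v [a [s [Gv -> ->]]]]; have [s0|s0|->] := ltgtP s 0; last first.
  + rewrite mul0r addr0 (_ : (fun l => _) = v); first exact: Gq.
    by apply/funext => l; rewrite mul0r addr0.
  + have := al_le _ _ (GZ s^-1 _ _ Gv); rewrite -(ler_pM2l s0) => H.
    have -> : q (fun l => v l + s%:C * u l) = s * q (fun l => s^-1%:C * v l + u l).
      rewrite -seminormZr ?(ltW s0) //; congr q; apply/funext => l.
      by rewrite mulrDr mulrA -rmorphM /= mulfV ?gt_eqF // mul1r.
    by move: H; rewrite mulrBr mulrA mulfV ?gt_eqF // mul1r; lra.
  + have r0 : 0 < - s by rewrite oppr_gt0.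
    have := al_ge _ _ (GZ (- s)^-1 _ _ Gv); rewrite -(ler_pM2l r0) => H.
    have -> : q (fun l => v l + s%:C * u l) = - s * q (fun l => (- s)^-1%:C * v l - u l).
      rewrite -seminormZr ?(ltW r0) //; congr q; apply/funext => l.
      by rewrite mulrBr mulrA -rmorphM /= mulfV ?gt_eqF // mul1r rmorphN /=; ring.
    by move: H; rewrite mulrBr mulrA mulfV ?gt_eqF // mul1r; lra.
Qed.

Lemma graph_extend (T : eqType) (s : seq T) (u : T -> L -> C) G :
  real_linear_graph G -> G (fun _ => 0) 0 ->
  exists G' : (L -> C) -> R -> Prop, [/\ real_linear_graph G',
    forall v a, G v a -> G' v a & forall k, k \in s -> exists a, G' (u k) a].
Proof.
elim: s G => [|k s IH] G hG G0; first by exists G; split.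
have [G1 [hG1 GG1 Gk]] := graph_extend1 (u k) hG G0.
have [G2 [hG2 G12 Gs]] := IH G1 hG1 (GG1 _ _ G0).
exists G2; split=> // [v a Gv|k']; first exact/G12/GG1.
rewrite inE => /orP[/eqP ->|]; last exact: Gs.
by case: Gk => a ?; exists a; exact: G12.
Qed.

(** The real part of [f] is extended along the finite real basis formed by the unit vectors and
    their multiples by i, so no maximality principle is needed; the complex functional is then
    rebuilt from its real part. *)
Lemma hahn_banach (I : finType) (J : L -> I -> C) (f : I -> C) :
  (forall x, cabs (\sum_i f i * x i) <= q (app J x)) ->
  exists F : L -> C, (forall x, \sum_l F l * app J x l = \sum_i f i * x i) /\
    forall y, cabs (\sum_l F l * y l) <= q y.
Proof.
move=> Hf.
pose G v a := exists x, v = app J x /\ a = complex.Re (\sum_i f i * x i).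
have sumZ (f' : I -> C) a x : \sum_i f' i * (a * x i) = a * \sum_i f' i * x i.
  by rewrite mulr_sumr; apply: eq_bigr => i _; rewrite mulrCA.
have sumZL (f' : L -> C) a x : \sum_i f' i * (a * x i) = a * \sum_i f' i * x i.
  by rewrite mulr_sumr; apply: eq_bigr => i _; rewrite mulrCA.
have ReZ (t : R) (z : C) : complex.Re (t%:C * z) = t * complex.Re z.
  by case: z => a b /=; rewrite mul0r subr0.
have hG : real_linear_graph G.
  split=> [_ _ _ _ [x [-> ->]] [y [-> ->]]|t _ _ [x [-> ->]]|_ _ [x [-> ->]]].
  - exists (fun i => x i + y i); rewrite appD; split=> //.
    by rewrite -ReD -big_split; under [in RHS]eq_bigr do rewrite mulrDr.
  - by exists (fun i => t%:C * x i); rewrite appZ sumZ ReZ.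
  - exact: le_trans (Re_le_cabs _) (Hf x).
have G0 : G (fun _ => 0) 0.
  exists (fun _ => 0); split; last by rewrite big1 // => i _; rewrite mulr0.
  by apply/funext => l; rewrite /app big1 // => i _; rewrite mulr0.
pose u (k : L * bool) l := (if k.2 then 'i else 1) * delta k.1 l : C.
have [G' [[GD GZ Gq] GG' Gu]] := graph_extend (enum {: L * bool}) u hG G0.
have /choice[a Ga] : forall k, exists a, G' (u k) a by move=> k; apply: Gu; rewrite mem_enum.
(* A complex functional is recovered from its real part g by x |-> g(x) - i g(ix). *)
pose F l : C := a (l, false) -i* a (l, true).
have GF y : G' y (complex.Re (\sum_l F l * y l)).
  have Gl l : G' (fun l' => y l * delta l l') (complex.Re (F l * y l)).
    have := GD _ _ _ _ (GZ (complex.Re (y l)) _ _ (Ga (l, false)))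
                       (GZ (complex.Im (y l)) _ _ (Ga (l, true))).
    rewrite /F; case: (y l) => c d /=; set v := fun _ => _ => H.
    rewrite (_ : (fun l' => _) = v).
      by rewrite (_ : _ - _ = c * a (l, false) + d * a (l, true)) //; ring.
    apply/funext => l'; rewrite /v /u /= !mulrA -mulrDl mulr1; congr (_ * _).
    by apply/eqP; rewrite eq_complex /= !mulr0 !mul0r !mulr1 subr0 !addr0 add0r !eqxx.
  rewrite [y in G' y _](_ : y = fun l' => \sum_l y l * delta l l'); last first.
    by apply/funext => l; exact: delta_sum.
  elim: (index_enum L) => [|l s IH].
    by rewrite big_nil; under eq_fun do rewrite big_nil; exact: GG'.
  by rewrite big_cons ReD; under eq_fun do rewrite big_cons; exact: GD.
exists F; split=> [x|y]; last first.
  have [t t1 tE] := cabs_phase (\sum_l F l * y l).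
  have := Gq _ _ (GF (fun l => t * y l)).
  by rewrite sumZL tE (seminormZ hq) t1 mul1r.
have ReE y : complex.Re (\sum_l F l * app J y l) = complex.Re (\sum_i f i * y i).
  have HJ : G' (app J y) (complex.Re (\sum_i f i * y i)) by apply: GG'; exists y.
  have H z w : G' (app J y) z -> G' (app J y) w -> z <= w.
    move=> Gz Gw; have := Gq _ _ (GD _ _ _ _ Gz (GZ (-1) _ _ Gw)).
    rewrite (_ : (fun l => _) = fun _ => 0).
      by rewrite (seminorm0 hq) mulN1r subr_le0.
    by apply/funext => l; rewrite rmorphN1 mulN1r subrr.
  by apply/eqP; rewrite eq_le !H.
apply/eqP; rewrite -subr_eq0; apply/eqP/cabs_eq0.
(* The real parts agree at every vector; rotating the difference onto its modulus shows that it
   vanishes. *)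
have [t t1 tE] := cabs_phase (\sum_l F l * app J x l - \sum_i f i * x i).
have := ReE (fun i => t * x i); rewrite appZ sumZL sumZ => /eqP; rewrite -subr_eq0.
have -> (z w : C) : complex.Re z - complex.Re w = complex.Re (z - w).
  by case: z; case: w.
by rewrite -mulrBr tE => /eqP.
Qed.

End HahnBanach.

(** * Almost optimal projections from finite nets *)

Section ProjectionConstant.
Variable R : realType.
Local Notation C := R[i].
Local Open Scope complex_scope.
Local Open Scope classical_set_scope.

Lemma grid (r e : R) : 0 < e -> exists (n : nat) (g : R -> 'I_n.+1),
  forall a b, `|a| <= r -> `|b| <= r -> g a = g b -> `|a - b| <= e.
Proof.
move=> e0; pose h a := Num.truncn ((a + r) / e).
exists (Num.truncn ((r + r) / e)), (fun a => inord (h a)).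
have hb a : `|a| <= r -> (h a < (Num.truncn ((r + r) / e)).+1)%N.
  rewrite ler_norml => /andP[a1 a2]; rewrite ltnS; apply: le_truncn.
  by rewrite ler_pM2r ?invr_gt0 // lerD2r.
move=> a b ar br /(congr1 (@nat_of_ord _)); rewrite !inordK ?hb // => hE.
have ha c : `|c| <= r -> (h c)%:R * e <= c + r < (h c)%:R * e + e.
  rewrite ler_norml => /andP[c1 c2].
  have : 0 <= (c + r) / e by rewrite divr_ge0 ?(ltW e0) //; lra.
  move=> /truncn_itv; rewrite -/(h c) ler_pdivlMr // ltr_pdivrMr //.
  by rewrite -natr1 mulrDl mul1r.
have := ha a ar; have := ha b br; rewrite hE ler_norml; move: (_ * e) => z.
by move=> /andP[? ?] /andP[? ?]; apply/andP; split; lra.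
Qed.

Lemma cabs_le_ReIm (z : C) : cabs z <= `|complex.Re z| + `|complex.Im z|.
Proof.
case: z => a b; rewrite /cabs /= -[leRHS]ger0_norm ?addr_ge0 // -sqrtr_sqr.
rewrite ler_wsqrtr // sqrrD !real_normK ?num_real // addrAC lerDl.
by rewrite mulrn_wge0 // mulr_ge0.
Qed.

Lemma Im_le_cabs (z : C) : `|complex.Im z| <= cabs z.
Proof.
case: z => a b; rewrite /cabs /= -sqrtr_sqr ler_wsqrtr //.
by rewrite lerDr sqr_ge0.
Qed.

Lemma norm_Re_le_cabs (z : C) : `|complex.Re z| <= cabs z.
Proof.
case: z => a b; rewrite /cabs /= -sqrtr_sqr ler_wsqrtr //.
by rewrite lerDl sqr_ge0.
Qed.

(** Total boundedness by pigeonhole: one representative for every nonempty product of grid cells,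
    with e/2 for real and for imaginary parts. The net lies in [S] itself, so whatever holds on [S]
    holds at its points. *)
Lemma finite_net (I : finType) (Z : Type) (S : set Z) (phi : Z -> I -> C) (r e : R) :
  S !=set0 -> (forall z, S z -> forall i, cabs (phi z i) <= r) -> 0 < e ->
  exists (M : nat) (zs : 'I_M -> Z), (forall j, S (zs j)) /\
    forall z, S z -> exists j, forall i, cabs (phi z i - phi (zs j) i) <= e.
Proof.
move=> [z0 Sz0] Sr e0; have [n [g Hg]] := @grid r (e / 2) ltac:(by rewrite divr_gt0).
pose T : finType := {ffun I -> 'I_n.+1 * 'I_n.+1}.
pose cell z : T := [ffun i => (g (complex.Re (phi z i)), g (complex.Im (phi z i)))].
have /choice [h Hh] : forall t : T, exists z, S z /\ ((exists2 w, S w & cell w = t) -> cell z = t).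
  move=> t; case: (pselect (exists2 w, S w & cell w = t)) => [[w Sw wt]|N].
    by exists w.
  by exists z0; split=> // /N.
exists #|T|, (fun j => h (enum_val j)); split=> [j|z Sz]; first by case: (Hh (enum_val j)).
exists (enum_rank (cell z)) => i; rewrite enum_rankK.
have [Sh /(_ (ex_intro2 _ _ z Sz erefl)) E] := Hh (cell z).
have := congr1 (fun t : T => t i) E; rewrite !ffunE => -[E1 E2].
apply: le_trans (cabs_le_ReIm _) _.
have ReB (v w : C) : complex.Re (v - w) = complex.Re v - complex.Re w by case: v; case: w.
have ImB (v w : C) : complex.Im (v - w) = complex.Im v - complex.Im w by case: v; case: w.
rewrite ReB ImB (splitr e) lerD // distrC; apply: Hg => //.
- by apply: le_trans (norm_Re_le_cabs _) _; exact: Sr.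
- by apply: le_trans (norm_Re_le_cabs _) _; exact: Sr.
- by apply: le_trans (Im_le_cabs _) _; exact: Sr.
- by apply: le_trans (Im_le_cabs _) _; exact: Sr.
Qed.

Section Embedding.
Variables (I : finType) (p : (I -> C) -> R).
Hypotheses (hp : seminorm p) (cp : coercive p).

(** Hahn-Banach applied to each coordinate functional. The bound does not depend on the embedding,
    which makes the supremum defining [projconst] finite. *)
Lemma exists_projection : exists2 B, 0 <= B &
  forall (L : finType) (q : (L -> C) -> R) (J : L -> I -> C), seminorm q ->
    (forall x, q (app J x) = p x) ->
    exists2 P : I -> L -> C, (forall x i, app P (app J x) i = x i) & opnorm q p P <= B.
Proof.
have [K K0 HK] := cp; have [M M0 HM] := seminorm_le_cabs hp.
exists (M * K) => [|L q J hq qJ]; first exact: mulr_ge0.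
have hKq : seminorm (fun y => K * q y).
  split=> [a y|y y']; first by rewrite (seminormZ hq) mulrCA.
  by rewrite -mulrDr ler_wpM2l ?(seminormD hq).
have dE x i : \sum_j delta i j * x j = x i :> C.
  rewrite [RHS](delta_sum x); apply: eq_bigr => j _.
  by rewrite mulrC /delta eq_sym.
have /choice [P HP] : forall i, exists F : L -> C,
    (forall x, \sum_l F l * app J x l = x i) /\ forall y, cabs (\sum_l F l * y l) <= K * q y.
  move=> i; have Hi x : cabs (\sum_j delta i j * x j) <= K * q (app J x) by rewrite dE qJ; exact: HK.
  have [F [F1 F2]] := hahn_banach hKq Hi.
  by exists F; split=> // x; rewrite F1 dE.
exists P => [x i|]; first by have [H _] := HP i; exact: H.
apply: (opnorm_le hq (mulr_ge0 M0 K0)) => y; rewrite -mulrA; apply: HM => i.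
by have [_ H] := HP i; exact: H.
Qed.

Lemma relproj_le_projconst (N : nat) (q : ('I_N -> C) -> R) (J : 'I_N -> I -> C) :
  is_norm q -> (forall x, q (app J x) = p x) -> relproj p q J <= projconst p.
Proof.
move=> hq qJ; apply: ub_le_sup; last by exists N, q, J.
have [B B0 HB] := exists_projection; exists B => _ [n' [q' [J' [hq' qJ' ->]]]].
have [P P1 P2] := HB _ q' J' (is_norm_seminorm hq') qJ'.
apply: le_trans P2; apply: ge_inf; last by exists P.
by exists 0 => _ [P' [_ ->]]; exact: opnorm_ge0.
Qed.

Lemma projconst_ge0 : 0 <= projconst p.
Proof.
apply: sup_ge0 => _ [N [q [J [hq _ ->]]]]; apply: inf_ge0 => _ [P [_ ->]].
exact: opnorm_ge0.
Qed.

Section Renorming.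
Variables (L : finType) (J : L -> I -> C) (c : R).
Hypotheses (c1 : 1 <= c) (Jp : forall x l, cabs (app J x l) <= p x)
  (pJ : forall x s, 0 <= s -> (forall l, cabs (app J x l) <= s) -> p x <= c * s).

Definition hull_set (y : L -> C) : set R :=
  [set r | exists x s, [/\ 0 <= s, forall l, cabs (y l - app J x l) <= s & r = p x + c * s]].

(* Gauge of the hull of the image of the unit ball of [p] and of the ball of
   radius [1 / c] of l_infinity; it makes [J] isometric. *)
Definition hull_norm (y : L -> C) : R := inf (hull_set y).

Let c0 : 0 <= c. Proof. exact: le_trans c1. Qed.

Lemma hull_set_ge0 y r : hull_set y r -> 0 <= r.
Proof. by move=> [x [s [s0 _ ->]]]; rewrite addr_ge0 ?mulr_ge0 ?seminorm_ge0. Qed.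

Lemma hull_set_neq0 y : hull_set y !=set0.
Proof.
exists (p (fun _ => 0) + c * \sum_l cabs (y l)), (fun _ => 0), (\sum_l cabs (y l)).
split=> //; first by apply: sumr_ge0 => l _; exact: cabs_ge0.
move=> l; rewrite /app big1 ?subr0; last by move=> i _; rewrite mulr0.
by rewrite (bigD1 l) //= lerDl sumr_ge0 // => k _; exact: cabs_ge0.
Qed.

Lemma hull_norm_le y r : hull_set y r -> hull_norm y <= r.
Proof. by apply: ge_inf; exists 0; exact: hull_set_ge0. Qed.

Lemma le_hull_norm y g : (forall r, hull_set y r -> g <= r) -> g <= hull_norm y.
Proof. by move=> H; apply: lb_le_inf => //; exact: hull_set_neq0. Qed.

Lemma hull_norm_ge0 y : 0 <= hull_norm y.
Proof. by apply: le_hull_norm; exact: hull_set_ge0. Qed.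

Lemma hull_norm_le_cabs y s : 0 <= s -> (forall l, cabs (y l) <= s) -> hull_norm y <= c * s.
Proof.
move=> s0 ys; apply: hull_norm_le; exists (fun _ => 0), s; split=> //.
  by move=> l; rewrite /app big1 ?subr0 // => i _; rewrite mulr0.
by rewrite (seminorm0 hp) add0r.
Qed.

(** Both pieces of a decomposition dominate their sup norm: the first by [Jp], the second since c is
    at least 1. Definiteness and coercivity of the hull norm follow. *)
Lemma cabs_le_hull_norm y l : cabs (y l) <= hull_norm y.
Proof.
apply: le_hull_norm => _ [x [s [s0 ys ->]]].
rewrite -[y l](subrK (app J x l)); apply: le_trans (cabsD _ _) _.
rewrite addrC lerD //; apply: le_trans (ys l) _.
by rewrite ler_peMl.
Qed.

(** Moving a part of [x] to the l_infinity piece never pays: if [J] maps x - x' into the ball of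
    radius s, then [pJ] gives p(x - x') at most c s. *)
Lemma hull_norm_app x : hull_norm (app J x) = p x.
Proof.
apply/eqP; rewrite eq_le; apply/andP; split.
  apply: hull_norm_le; exists x, 0; split=> // [l|]; first by rewrite subrr cabs0.
  by rewrite mulr0 addr0.
apply: le_hull_norm => _ [x' [s [s0 ys ->]]].
rewrite (_ : x = fun i => x' i + (x i + (-1) * x' i)); last by apply/funext => i; ring.
apply: le_trans (seminormD hp _ _) _; rewrite lerD2l; apply: pJ => // l.
by rewrite appD appZ mulN1r.
Qed.

Lemma hull_normZ_le a y : hull_norm (fun l => a * y l) <= cabs a * hull_norm y.
Proof.
apply: le_mul_inf; [exact: hull_set_neq0|exact: hull_set_ge0|exact: cabs_ge0|].
move=> _ [x [s [s0 ys ->]]]; apply: hull_norm_le.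
exists (fun i => a * x i), (cabs a * s); split=> [|l|].
- by rewrite mulr_ge0 ?cabs_ge0.
- by rewrite appZ -mulrBr cabsM ler_wpM2l ?cabs_ge0.
- by rewrite (seminormZ hp); ring.
Qed.

Lemma hull_norm_is_norm : is_norm hull_norm.
Proof.
split=> [y y0 l|a y|y z].
- by apply/cabs_eq0/eqP; rewrite eq_le cabs_ge0 andbT -y0 cabs_le_hull_norm.
- apply/eqP; rewrite eq_le hull_normZ_le /=.
  have [->|a0] := eqVneq a 0; first by rewrite cabs0 mul0r hull_norm_ge0.
  have ca : 0 < cabs a.
    by rewrite lt_def cabs_ge0 andbT; apply: contra_neq a0; exact: cabs_eq0.
  rewrite mulrC -ler_pdivlMr // mulrC -cabsV; apply: le_trans (hull_normZ_le _ _).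
  by rewrite le_eqVlt; apply/orP; left; apply/eqP; congr hull_norm; apply/funext => l; rewrite mulKf.
- rewrite -lerBlDr; apply: le_hull_norm => _ [x [s [s0 ys ->]]].
  rewrite lerBlDr -lerBlDl; apply: le_hull_norm => _ [x' [s' [s'0 ys' ->]]].
  rewrite lerBlDl; apply: (@le_trans _ _ (p (fun i => x i + x' i) + c * (s + s'))).
    apply: hull_norm_le; exists (fun i => x i + x' i), (s + s'); split=> [|l|//].
      exact: addr_ge0.
    rewrite appD opprD addrACA; apply: le_trans (cabsD _ _) _; exact: lerD.
  have := seminormD hp x x'; rewrite mulrDr; lra.
Qed.

End Renorming.

(* Although [projconst] only concerns isometric embeddings, a finite net of the
   index set [S] gives an almost isometric one into a finite-dimensional
   l_infinity; renorming it makes it isometric. *)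
Lemma projconst_net (Z : Type) (S : set Z) (phi : Z -> I -> C) (r lam : R) :
  S !=set0 -> (forall z, S z -> forall i, cabs (phi z i) <= r) ->
  (forall x z, S z -> cabs (\sum_i phi z i * x i) <= p x) ->
  (forall x s, (forall z, S z -> cabs (\sum_i phi z i * x i) <= s) -> p x <= s) ->
  projconst p < lam ->
  exists (M : nat) (zs : 'I_M -> Z) (P : I -> 'I_M -> C),
    [/\ forall j, S (zs j),
        forall x i, app P (fun j => \sum_i phi (zs j) i * x i) i = x i &
        forall y s, 0 <= s -> (forall j, cabs (y j) <= s) -> p (app P y) <= lam * s].
Proof.
move=> S0 Sr phip pphi lamP; have p0 := projconst_ge0.
(* The room between the projection constant and [lam] is split in two: a projection of norm below
   [mu] for the hull norm, and the factor [c = lam / mu] comparing that norm with the sup norm. *)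
pose mu := (projconst p + lam) / 2.
have mu0 : 0 < mu by rewrite /mu; lra.
have pmu : projconst p < mu by rewrite /mu; lra.
have mulam : mu < lam by rewrite /mu; lra.
have lam0 : 0 < lam by lra.
pose c := lam / mu; have c1 : 1 < c by rewrite ltr_pdivlMr // mul1r.
have [K K0 HK] := cp; pose K1 := #|I|%:R * K.
have K10 : 0 <= K1 by rewrite mulr_ge0.
(* Replacing a point of [S] by a net point changes the value at [x] by at most [e * K1 * p x]; this
   choice keeps it below [(1 - c^-1) * p x], and absorbing that term on the left yields
   [p x <= c * s]. *)
pose e := (1 - c^-1) / (K1 + 1).
have c0 : 0 < c by lra.
have ic1 : 0 < 1 - c^-1 by rewrite subr_gt0 invf_lt1.
have e0 : 0 < e by rewrite divr_gt0 // ltr_wpDl.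
have eK : e * K1 <= 1 - c^-1.
  by rewrite mulrAC ler_pdivrMr ?ltr_wpDl // ler_wpM2l ?(ltW ic1) // lerDl.
have [M [zs [Szs net]]] := finite_net S0 Sr e0.
pose J (j : 'I_M) i := phi (zs j) i.
have Jp x l : cabs (app J x l) <= p x by exact: phip.
have pJ x s : 0 <= s -> (forall l, cabs (app J x l) <= s) -> p x <= c * s.
  move=> s0 Hs; suff H : p x <= s + (1 - c^-1) * p x.
    by rewrite -ler_pdivrMl //; lra.
  apply: pphi => z Sz; have [j Hj] := net z Sz.
  have -> : \sum_i phi z i * x i = app J x j + \sum_i (phi z i - phi (zs j) i) * x i.
    by rewrite /app -big_split; apply: eq_bigr => i _ /=; rewrite /J; ring.
  apply: le_trans (cabsD _ _) (lerD (Hs j) _).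
  apply: le_trans (ler_wpM2r (seminorm_ge0 hp x) eK); apply: le_trans (cabs_sum _ _ _) _.
  have -> : e * K1 * p x = \sum_(i in I) e * (K * p x).
    by rewrite sumr_const -mulr_natl /K1; ring.
  rewrite [leRHS](eq_bigl xpredT) //; apply: ler_sum => i _.
  by rewrite cabsM; apply: ler_pM; rewrite ?cabs_ge0.
have hq := hull_norm_is_norm (ltW c1) Jp.
have qJ := hull_norm_app (ltW c1) pJ.
pose q := hull_norm J c; have hq' : seminorm q := is_norm_seminorm hq.
have := le_lt_trans (relproj_le_projconst hq qJ) pmu.
have cq : coercive q.
  by exists 1 => // y l; rewrite mul1r; exact: cabs_le_hull_norm (ltW c1) Jp _ _.
rewrite -subr_gt0 => gap.
pose E := [set s : R | exists P : I -> 'I_M -> C,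
  (forall x i, app P (app J x) i = x i) /\ s = opnorm q p P].
have [|_ [P [P1 ->]] P2] := @inf_adherent _ E _ gap.
  split; last by exists 0 => _ [P' [_ ->]]; exact: opnorm_ge0.
  have [B _ HB] := exists_projection; have [P P1 _] := HB _ q J hq' qJ.
  by exists (opnorm q p P), P.
exists M, zs, P; split=> // y s s0 ys.
apply: le_trans (opnorm_bound hq' cq hp P y) _.
have -> : lam * s = mu * (c * s) by rewrite mulrA /c mulrCA mulfV ?mulr1 // gt_eqF.
apply: ler_pM => //.
- exact: opnorm_ge0.
- exact: hull_norm_ge0 (ltW c1) _.
- by apply/ltW; move: P2; rewrite -[inf E]/(relproj p q J) addrC subrK.
- exact: hull_norm_le_cabs (ltW c1) _ _ _ _.
Qed.

End Embedding.
End ProjectionConstant.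

(** * Cauchy estimates *)

Section Cauchy.
Variable R : realType.
Local Notation C := R[i].
Local Open Scope complex_scope.

(** Orthogonality of the characters of Z/d: for distinct l, k below d the ratio differs from 1 while
    its d-th power is 1, so the geometric sum vanishes. *)
Lemma prim_root_orth (d : nat) (w : C) (l k : nat) : d.-primitive_root w ->
  (l < d)%N -> (k < d)%N ->
  \sum_(j < d) (w ^+ l / w ^+ k) ^+ j = (if l == k then d%:R else 0).
Proof.
move=> pw ld kd; have d0 := prim_order_gt0 pw.
have w0 : w != 0.
  apply/eqP => w0; move: (prim_expr_order pw).
  by rewrite w0 expr0n gtn_eqF //= => /esym/eqP; rewrite oner_eq0.
case: eqP => [->|/eqP lk].
  rewrite divff ?expf_neq0 //; under eq_bigr do rewrite expr1n.
  by rewrite sumr_const card_ord.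
set z := w ^+ l / w ^+ k.
have z1 : z - 1 != 0.
  apply: contra_neq lk => /subr0_eq z1; apply/eqP.
  have : w ^+ l == w ^+ k by apply/eqP; rewrite -[RHS]mul1r -z1 divfK ?expf_neq0.
  by rewrite (eq_prim_root_expr pw) !modn_small.
apply: (mulfI z1); rewrite mulr0 -subrX1 /z expr_div_n -!exprM.
by rewrite mulnC [(k * d)%N]mulnC !exprM (prim_expr_order pw) !expr1n divr1 subrr.
Qed.

Lemma cabs_prim_root (d : nat) (w : C) : d.-primitive_root w -> cabs w = 1.
Proof.
move=> pw; apply/eqP; rewrite -(pexpr_eq1 (prim_order_gt0 pw)) ?cabs_ge0 //.
by rewrite -cabsX (prim_expr_order pw) cabs1.
Qed.

(* Cauchy's estimate, the circle of radius [r] being replaced by a discrete one. *)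
Lemma cauchy_coef (q : {poly C}) (k : nat) (r s : R) : 0 <= r ->
  (forall t : C, cabs t = r -> cabs q.[t] <= s) -> cabs q`_k * r ^+ k <= s.
Proof.
(* With d larger than k and than the degree of q, distinct exponents stay distinct modulo d, so the
   discrete average isolates the k-th coefficient exactly. *)
move=> r0 H; pose d := (maxn (size q) k).+1.
have kd : (k < d)%N by rewrite ltnS leq_maxr.
have qd : (size q <= d)%N by rewrite leqW // leq_maxl.
have [w pw] := @exists_prim_root R d isT; have w1 := cabs_prim_root pw.
have d0 : 0 < d%:R :> R by rewrite ltr0n.
have E : d%:R * (q`_k * r%:C ^+ k) = \sum_(j < d) (w ^+ k)^-1 ^+ j * q.[r%:C * w ^+ j].
  under eq_bigr do rewrite (horner_coef_wide _ qd) mulr_sumr.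
  rewrite exchange_big (bigD1 (Ordinal kd)) //= [X in _ + X]big1 => [|l lk].
    rewrite addr0 -[d%:R in LHS](_ : \sum_(j < d) (w ^+ k / w ^+ k) ^+ j = _).
      rewrite mulr_suml; apply: eq_bigr => j _.
      by rewrite !exprMn -!exprM [(j * k)%N]mulnC; ring.
    by rewrite prim_root_orth // eqxx.
  transitivity (q`_l * r%:C ^+ l * \sum_(j < d) (w ^+ l / w ^+ k) ^+ j).
    rewrite mulr_sumr; apply: eq_bigr => j _.
    by rewrite !exprMn -!exprM [(j * l)%N]mulnC; ring.
  by rewrite prim_root_orth // ifN ?mulr0.
rewrite -(ler_pM2l d0) -[d%:R in leLHS](cabs_nat R) -[r in leLHS](cabs_real r0) -cabsX -!cabsM E.
apply: le_trans (cabs_sum _ _ _) _.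
have -> : d%:R * s = \sum_(j < d) s by rewrite sumr_const card_ord mulr_natl.
apply: ler_sum => j _; rewrite cabsM cabsX cabsV cabsX w1 expr1n invr1 expr1n mul1r.
by apply: H; rewrite cabsM cabsX w1 expr1n mulr1 cabs_real.
Qed.

End Cauchy.

(** * Polynomials on the unit ball: coefficients, homogeneous parts, derivatives *)

Section Polynomials.
Variables (R : realType) (n d : nat).
Local Notation C := R[i].
Local Open Scope complex_scope.
Local Open Scope classical_set_scope.
Variable N : ('I_n -> C) -> R.
Hypothesis latN : banach_lattice N.

Let hN : seminorm N. Proof. by case: latN => /is_norm_seminorm. Qed.

Definition peval (c : Multi n d -> C) (z : 'I_n -> C) : C := \sum_a c a * mono a z.

Lemma ball_contains_polydisc : exists2 r, 0 < r & forall z, (forall i, cabs (z i) <= r) -> N z <= 1.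
Proof.
have [K K0 HK] := seminorm_le_cabs hN.
have K1 : 0 < K + 1 by rewrite ltr_wpDl.
exists (K + 1)^-1; first by rewrite invr_gt0.
move=> z /HK; move/le_trans; apply; rewrite ler_pdivrMr // mul1r; lra.
Qed.

(** The vector z_i e_i is dominated coordinatewise by z, so the lattice property bounds |z_i| N(e_i)
    by N(z). *)
Lemma lattice_coercive : coercive N.
Proof.
have [hn mono_N] := latN.
have N0 i : 0 < N (delta i).
  rewrite lt_def seminorm_ge0 // andbT; apply/eqP => Ni; have [h _ _] := hn.
  by have /eqP := h _ Ni i; rewrite /delta eqxx oner_eq0.
exists (\sum_i (N (delta i))^-1).
  by apply: sumr_ge0 => i _; rewrite invr_ge0 seminorm_ge0.
move=> z i; rewrite (bigD1 i) //= mulrDl -[leLHS]addr0 lerD //; last first.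
  by rewrite mulr_ge0 ?seminorm_ge0 // sumr_ge0 // => j _; rewrite invr_ge0 seminorm_ge0.
rewrite mulrC ler_pdivlMr // -(seminormZ hN); apply: mono_N => k.
by rewrite /delta cabsM cabs_nat; case: eqP => [->|_]; rewrite ?mulr1 ?mulr0 ?cabs_ge0.
Qed.

Lemma mono_bounded : exists2 M, 0 <= M &
  forall z, N z <= 1 -> forall a : Multi n d, cabs (mono a z) <= M.
Proof.
have [K K0 HK] := lattice_coercive.
have M0 (a : Multi n d) : 0 <= \prod_(i < n) K ^+ (a i : nat).
  by apply: prodr_ge0 => i _; exact: exprn_ge0.
exists (\sum_(a : Multi n d) \prod_(i < n) K ^+ (a i : nat)); first exact: sumr_ge0.
move=> z z1 a; rewrite (bigD1 a) //= -[leLHS]addr0 lerD ?sumr_ge0 //.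
rewrite cabs_prod; apply: ler_prod => i _; rewrite cabs_ge0 cabsX lerXn2r ?nnegrE ?cabs_ge0 //.
by apply: le_trans (HK z i) _; rewrite ler_piMr.
Qed.

Lemma peval_le_polynorm c z : N z <= 1 -> cabs (peval c z) <= polynorm N c.
Proof.
move=> z1; apply: ub_le_sup; last by exists z.
have [M M0 HM] := mono_bounded.
exists (\sum_a cabs (c a) * M) => _ [w /= w1 <-].
apply: le_trans (cabs_sum _ _ _) _; apply: ler_sum => a _.
by rewrite cabsM ler_wpM2l ?cabs_ge0 ?HM.
Qed.

Lemma polynorm_le c s : (forall z, N z <= 1 -> cabs (peval c z) <= s) -> polynorm N c <= s.
Proof.
move=> H; apply: ge_sup; last by move=> _ [z /= z1 <-]; exact: H.
exists (cabs (peval c (fun _ => 0))), (fun _ => 0) => //=.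
by rewrite (seminorm0 hN) ler01.
Qed.

Lemma pevalZ a c z : peval (fun b => a * c b) z = a * peval c z.
Proof. by rewrite /peval mulr_sumr; apply: eq_bigr => b _; rewrite mulrA. Qed.

Lemma polynorm_seminorm : seminorm (@polynorm R n d N).
Proof.
have Z a (c : Multi n d -> C) : polynorm N (fun b => a * c b) <= cabs a * polynorm N c.
  apply: polynorm_le => z z1; rewrite pevalZ cabsM ler_wpM2l ?cabs_ge0 //.
  exact: peval_le_polynorm.
split=> [a c|c c'].
  have [->|a0] := eqVneq a 0.
    apply/eqP; rewrite eq_le Z cabs0 mul0r /=.
    apply: le_trans (peval_le_polynorm _ (_ : N (fun _ => 0) <= 1)).
      exact: cabs_ge0.
    by rewrite (seminorm0 hN) ler01.
  apply/eqP; rewrite eq_le Z /=.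
  have ca : 0 < cabs a.
    by rewrite lt_def cabs_ge0 andbT; apply: contra_neq a0; exact: cabs_eq0.
  rewrite mulrC -ler_pdivlMr // mulrC -cabsV; apply: le_trans (Z _ _).
  by rewrite le_eqVlt; apply/orP; left; apply/eqP; congr polynorm; apply/funext => l; rewrite mulKf.
apply: polynorm_le => z z1.
apply: le_trans (lerD (peval_le_polynorm c z1) (peval_le_polynorm c' z1)).
apply: le_trans (cabsD _ _); rewrite /peval -big_split /=.
by under eq_bigr do rewrite mulrDl.
Qed.

(* Each coefficient is a combination of values at finitely many points of a
   polydisc: iterate in every variable the discrete Cauchy formula. *)
Lemma polynorm_coercive : (0 < d)%N -> coercive (@polynorm R n d N).
Proof.
move=> d0; have [w pw] := @exists_prim_root R d d0; have w1 := cabs_prim_root pw.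
have [r r0 Hr] := ball_contains_polydisc.
(* Since all exponents are below d, d sample points per variable suffice. *)
pose pt (f : {ffun 'I_n -> 'I_d}) (i : 'I_n) := r%:C * w ^+ (f i : nat).
have ptN f : N (pt f) <= 1.
  by apply: Hr => i; rewrite cabsM cabsX w1 expr1n mulr1 cabs_real ?(ltW r0).
pose W (b : Multi n d) (f : {ffun 'I_n -> 'I_d}) : C :=
  \prod_i ((r%:C ^+ (b i : nat) * d%:R)^-1 * (w ^+ (b i : nat))^-1 ^+ (f i : nat)).
have rC : r%:C != 0 by rewrite (_ : 0 = 0%:C) // (inj_eq (@complexI R)) gt_eqF.
have dC : d%:R != 0 :> C by rewrite pnatr_eq0 -lt0n.
have E c b : c b = \sum_f W b f * peval c (pt f).
  under eq_bigr do rewrite mulr_sumr.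
  rewrite exchange_big /= (bigD1 b) //=.
  have F (a : Multi n d) :
      \sum_f W b f * (c a * mono a (pt f)) = c a * \prod_i (if a i == b i then 1 else 0).
    pose G i (j : 'I_d) := (r%:C ^+ (b i : nat) * d%:R)^-1 *
      (w ^+ (b i : nat))^-1 ^+ (j : nat) * (r%:C * w ^+ (j : nat)) ^+ (a i : nat).
    transitivity (c a * \sum_(f : {ffun 'I_n -> 'I_d}) \prod_i G i (f i)).
      rewrite mulr_sumr; apply: eq_bigr => f _.
      by rewrite mulrCA; congr (_ * _); rewrite /W /mono -big_split.
    congr (_ * _); rewrite -(bigA_distr_bigA G); apply: eq_bigr => i _.
    transitivity ((r%:C ^+ (b i : nat) * d%:R)^-1 * r%:C ^+ (a i : nat) *
        \sum_(j < d) (w ^+ (a i : nat) / w ^+ (b i : nat)) ^+ j).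
      rewrite mulr_sumr; apply: eq_bigr => j _; rewrite /G !exprMn -!exprM [(j * a i)%N]mulnC.
      by ring.
    rewrite prim_root_orth // -val_eqE; case: eqP => [->|]; last by rewrite mulr0.
    by field; rewrite dC expf_neq0.
  rewrite F [in X in X + _]big1 => [|i _]; last by rewrite eqxx.
  rewrite mulr1 big1 ?addr0 // => a ab.
  have [i iab] : exists i, a i != b i.
    apply/existsP; rewrite -negb_forall; apply: contra ab => /forallP H.
    by apply/eqP/ffunP => i; apply/eqP.
  by rewrite F (bigD1 i) //= (negbTE iab) mul0r mulr0.
exists (\sum_b \sum_f cabs (W b f)).
  by apply: sumr_ge0 => b _; apply: sumr_ge0 => f _; exact: cabs_ge0.
move=> c b; rewrite [in leLHS]E; apply: le_trans (cabs_sum _ _ _) _.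
rewrite [X in _ <= X * _](bigD1 b) //= mulrDl -[leLHS]addr0 lerD //; last first.
  rewrite mulr_ge0 ?(seminorm_ge0 polynorm_seminorm) //.
  by apply: sumr_ge0 => b' _; apply: sumr_ge0 => f _; exact: cabs_ge0.
rewrite mulr_suml; apply: ler_sum => f _.
by rewrite cabsM ler_wpM2l ?cabs_ge0 ?peval_le_polynorm.
Qed.

Lemma mono_scale (a : Multi n d) (t : C) (z : 'I_n -> C) :
  mono a (fun i => t * z i) = t ^+ mdeg a * mono a z.
Proof.
rewrite /mono /mdeg expr_sum -big_split /=; apply: eq_bigr => i _.
by rewrite exprMn.
Qed.

Definition hpart (k : nat) (c : Multi n d -> C) : Multi n d -> C :=
  fun a => if mdeg a == k then c a else 0.

(** The k-homogeneous part at z is the k-th coefficient of t |-> P(tz); Cauchy's estimate on the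
    unit circle applies because the ball is stable under unimodular scalars. *)
Lemma polynorm_hpart k c : polynorm N (hpart k c) <= polynorm N c.
Proof.
apply: polynorm_le => z z1.
pose q : {poly C} := \sum_a (c a * mono a z) *: 'X^(mdeg a).
have -> : peval (hpart k c) z = q`_k.
  rewrite coef_sum; apply: eq_bigr => a _; rewrite coefZ coefXn eq_sym /hpart.
  by case: eqP; rewrite ?mulr1 // mul0r mulr0.
have := @cauchy_coef R q k 1 (polynorm N c) ler01; rewrite expr1n mulr1; apply.
move=> t t1; have -> : q.[t] = peval c (fun i => t * z i).
  rewrite horner_sum; apply: eq_bigr => a _.
  by rewrite hornerZ hornerXn mono_scale mulrCA mulrC mulrA.
by apply: peval_le_polynorm; rewrite (seminormZ hN) t1 mul1r.
Qed.

(** Leibniz rule for the derivative of a product at 0. *)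
Lemma coef1_prod (I : eqType) (r : seq I) (F : I -> {poly C}) : uniq r ->
  (\prod_(i <- r) F i)`_1 = \sum_(i <- r) (F i)`_1 * \prod_(j <- r | j != i) (F j)`_0.
Proof.
elim: r => [_|i r IH /= /andP[ir ur]]; first by rewrite !big_nil coef1.
have c0 : (\prod_(j <- r) F j)`_0 = \prod_(j <- r) (F j)`_0.
  by apply: (big_morph (fun p : {poly C} => p`_0)) => [p q|]; rewrite ?coef0M ?coef1.
rewrite !big_cons eqxx /= coefM big_ord_recr big_ord1 /= subn0 subnn IH // c0 addrC.
congr (_ * _ + _).
  rewrite [LHS]big_seq [RHS]big_seq_cond; apply: eq_bigl => j.
  by case: eqVneq => [->|]; rewrite ?andbT // (negbTE ir).
rewrite mulr_sumr [LHS]big_seq [RHS]big_seq; apply: eq_bigr => j jr.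
rewrite big_cons; case: eqVneq => [ij|_]; first by rewrite ij jr in ir.
by rewrite mulrCA.
Qed.

(** The i-th partial derivative of z^a. At [a i = 0] the truncated predecessor is harmless, since
    the leading factor is 0. *)
Definition dmono (i : 'I_n) (a : Multi n d) (z : 'I_n -> C) : C :=
  (a i : nat)%:R * (z i ^+ (a i).-1 * \prod_(j < n | j != i) z j ^+ (a j : nat)).

Lemma coef1_mono (a : Multi n d) (z w : 'I_n -> C) :
  (\prod_i ((z i)%:P + w i *: 'X) ^+ (a i : nat))`_1 = \sum_i w i * dmono i a z.
Proof.
have P0 (x y : C) m : ((x%:P + y *: 'X) ^+ m)`_0 = x ^+ m.
  by rewrite -horner_coef0 horner_exp !hornerE.
have P1 (x y : C) m : ((x%:P + y *: 'X) ^+ m)`_1 = y * (m%:R * x ^+ m.-1).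
  rewrite -[LHS]mulr1n -[LHS](coef_deriv _ 0) deriv_exp derivD derivC derivZ derivX add0r.
  by rewrite coefMn -scalerAl mul1r coefZ P0 -mulrnAr mulr_natl.
rewrite coef1_prod ?index_enum_uniq //; apply: eq_bigr => i _.
by rewrite P1 /dmono; under eq_bigr do rewrite P0; rewrite -!mulrA.
Qed.

(* Polarization: Cauchy's estimate on the circle of radius [1 / k] for
   [t |-> P (z + t w)]. *)
Lemma derivative_bound (k : nat) (c : Multi n d -> C) (z w : 'I_n -> C) : (0 < k)%N ->
  (forall a, mdeg a != k -> c a = 0) -> N z <= 1 -> N w <= 1 ->
  cabs (\sum_i w i * \sum_a c a * dmono i a z) <= k%:R * expR 1 * polynorm N c.
Proof.
move=> k0 ck z1 w1.
have kR : 0 < k%:R :> R by rewrite ltr0n.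
pose r : R := k%:R^-1; have r0 : 0 < r by rewrite invr_gt0.
pose q : {poly C} := \sum_a c a *: \prod_i ((z i)%:P + w i *: 'X) ^+ (a i : nat).
have -> : \sum_i w i * (\sum_a c a * dmono i a z) = q`_1.
  rewrite coef_sum; under [RHS]eq_bigr do rewrite coefZ coef1_mono mulr_sumr.
  under [LHS]eq_bigr do rewrite mulr_sumr.
  by rewrite exchange_big; apply: eq_bigr => a _; apply: eq_bigr => i _; rewrite mulrCA.
have s0 : 0 < 1 + r by rewrite addr_gt0.
(* The point z + t w lies in the ball of radius 1 + r; dividing by 1 + r and using homogeneity costs
   (1 + r)^k. *)
have Hq (t : C) : cabs t = r -> cabs q.[t] <= (1 + r) ^+ k * polynorm N c.
  move=> tr; pose v i := (1 + r)^-1%:C * (z i + t * w i).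
  have sC : (1 + r)%:C != 0 :> C.
    by rewrite (_ : 0 = 0%:C) // (inj_eq (@complexI R)) gt_eqF.
  have -> : q.[t] = peval c (fun i => (1 + r)%:C * v i).
    rewrite horner_sum; apply: eq_bigr => a _.
    rewrite hornerZ horner_prod /mono; congr (_ * _); apply: eq_bigr => i _.
    rewrite horner_exp; congr (_ ^+ _).
    by rewrite hornerD hornerC hornerZ hornerX /v fmorphV mulVKf // mulrC.
  have -> : peval c (fun i => (1 + r)%:C * v i) = (1 + r)%:C ^+ k * peval c v.
    rewrite /peval mulr_sumr; apply: eq_bigr => a _; rewrite mono_scale.
    by have [->|/ck ->] := eqVneq (mdeg a) k; [rewrite mulrCA|rewrite !mul0r mulr0].
  rewrite cabsM cabsX cabs_real ?(ltW s0) // ler_wpM2l ?exprn_ge0 ?(ltW s0) //.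
  apply: peval_le_polynorm; rewrite /v (seminormZ hN) cabs_real ?invr_ge0 ?(ltW s0) //.
  rewrite ler_pdivrMl // mulr1; apply: le_trans (seminormD hN _ _) _.
  by rewrite lerD // (seminormZ hN) tr ler_piMr ?(ltW r0).
have := @cauchy_coef _ q 1 _ _ (ltW r0) Hq; rewrite expr1 ler_pdivrMr // mulrC => H; apply: le_trans H _.
rewrite -mulrA ler_wpM2l ?(ltW kR) // ler_wpM2r ?(seminorm_ge0 polynorm_seminorm) //.
(* Origin of the constant e: (1 + 1/k)^k is at most e. The remaining factor k, from dividing by the
   radius, later cancels the 1/k of Euler's identity. *)
have -> : expR 1 = expR r ^+ k :> R by rewrite -expRM_natl mulfV ?gt_eqF.
by rewrite lerXn2r ?nnegrE ?expR_ge0 ?(ltW s0) ?expR_ge1Dx.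
Qed.

End Polynomials.

(** * Factorization of homogeneous parts *)

Section PolynomialSpaces.
Variables (R : realType) (n d : nat).
Local Notation C := R[i].
Local Open Scope complex_scope.
Local Open Scope classical_set_scope.
Variable N : ('I_n -> C) -> R.
Hypothesis latN : banach_lattice N.

Let hN : seminorm N. Proof. by case: latN => /is_norm_seminorm. Qed.

Section Extension.
Variable J : {set Multi n d}.
Local Notation supp := {a : Multi n d | a \in J}.

(** Extension by zero, written as a 0/1 matrix so that the lemmas on [app] transfer seminorms. *)
Definition ext (x : supp -> C) : Multi n d -> C := app (fun a b => (val b == a)%:R) x.

Lemma ext_val x (b : supp) : ext x (val b) = x b.
Proof.
rewrite /ext /app (bigD1 b) //= eqxx mul1r big1 ?addr0 // => b' b'b.
by rewrite (inj_eq val_inj) (negbTE b'b) mul0r.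
Qed.

Lemma ext_out x a : a \notin J -> ext x a = 0.
Proof.
move=> aJ; rewrite /ext /app big1 // => b _; case: eqP => [ba|_]; last by rewrite mul0r.
by rewrite -ba (valP b) in aJ.
Qed.

Lemma ext_eq x (c : Multi n d -> C) : (forall b : supp, x b = c (val b)) ->
  ext x = fun a => if a \in J then c a else 0.
Proof.
move=> xc; apply/funext => a; case: ifPn => aJ; last exact: ext_out.
by rewrite -[a]/(val (exist (fun a => a \in J) a aJ)) ext_val xc.
Qed.

Lemma peval_ext x z : peval (ext x) z = \sum_(a : supp) x a * mono (val a) z.
Proof.
rewrite /peval /ext /app; under eq_bigr do rewrite mulr_suml.
rewrite exchange_big /=; apply: eq_bigr => b _.
rewrite (bigD1 (val b)) //= eqxx mul1r big1 ?addr0 // => a ab.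
by rewrite eq_sym (negbTE ab) !mul0r.
Qed.

Lemma PJnormE x : PJnorm N J x = polynorm N (ext x).
Proof.
rewrite /PJnorm /polynorm; congr sup; apply/seteqP; split=> _ [z z1 <-]; exists z => //.
  by rewrite -peval_ext.
by rewrite -/(peval (ext x) z) peval_ext.
Qed.

Lemma PJnorm_seminorm : seminorm (PJnorm N J).
Proof.
rewrite (_ : PJnorm N J = fun x => polynorm N (ext x)); last by apply/funext => x; exact: PJnormE.
exact: (seminorm_app _ (polynorm_seminorm d latN)).
Qed.

Lemma PJnorm_coercive : (0 < d)%N -> coercive (PJnorm N J).
Proof.
move=> d0; have [K K0 HK] := polynorm_coercive latN d0.
by exists K => // x i; rewrite PJnormE -ext_val.
Qed.

Lemma cabs_le_PJnorm x z : N z <= 1 -> cabs (\sum_(a : supp) x a * mono (val a) z) <= PJnorm N J x.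
Proof. by move=> z1; rewrite PJnormE -peval_ext; exact: peval_le_polynorm. Qed.

Lemma PJnorm_le x s :
  (forall z, N z <= 1 -> cabs (\sum_(a : supp) x a * mono (val a) z) <= s) -> PJnorm N J x <= s.
Proof. by move=> H; rewrite PJnormE; apply: polynorm_le => // z /H; rewrite peval_ext. Qed.

End Extension.

Lemma Qnorm_bound (L J : {set Multi n d}) (c : Multi n d -> C) : (0 < d)%N ->
  (forall a, a \notin L -> c a = 0) ->
  polynorm N (fun a => if a \in J then c a else 0) <= Qnorm N L J * polynorm N c.
Proof.
move=> d0 cL; have hp := polynorm_seminorm d latN.
pose A (a b : Multi n d) : C := if b \in J then (a == b)%:R else 0.
have AE c' : (fun a => if a \in J then c' a else 0) = app A c'.
  apply/funext => a; rewrite /app /A (bigD1 a) //= eqxx big1 => [|b ba].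
    by rewrite addr0; case: ifP => _; rewrite ?mul1r ?mul0r.
  by rewrite eq_sym (negbTE ba); case: ifP => _; rewrite mul0r.
have [M M0 HM] := seminorm_dominated (polynorm_coercive latN d0) (seminorm_app A hp).
apply: (le_sup_ball hp (f := fun c => polynorm N (fun a => if a \in J then c a else 0)) (K := M)).
- by move=> c' [_ c'1]; rewrite AE; apply: le_trans (HM c') _; rewrite ler_piMr.
- move=> t t0 tc; split=> [a /cL ->|]; first by rewrite mulr0.
  by rewrite (seminormZ hp) cabs_real.
- by move=> t t0; rewrite !AE appZ (seminormZ hp) cabs_real.
- by rewrite AE.
Qed.

Section Increments.
Implicit Types a b : Multi n d.

(** The relation b = a + e_i, in the form used by [flat]. It is a relation because a + e_i may leave
    the exponents below d. *)
Definition incr (i : 'I_n) (a b : Multi n d) : bool :=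
  ((b i : nat) == (a i).+1) && [forall j : 'I_n, (j != i) ==> ((b j : nat) == a j)].

Lemma incrP i a b : reflect ((b i : nat) = (a i).+1 /\ forall j, j != i -> (b j : nat) = a j)
  (incr i a b).
Proof.
apply: (iffP andP) => [[/eqP -> /forallP H]|[-> H]]; split=> //.
  by move=> j ji; apply/eqP; move/implyP: (H j); apply.
by apply/forallP => j; apply/implyP => /H ->.
Qed.

Lemma incr_injl i a a' b : incr i a b -> incr i a' b -> a = a'.
Proof.
move=> /incrP[H1 H2] /incrP[H1' H2']; apply/ffunP => j; apply: val_inj => /=.
have [->|ji] := eqVneq j i; first by apply: succn_inj; rewrite -H1.
by rewrite -H2 // H2'.
Qed.

Lemma incr_injr i a b b' : incr i a b -> incr i a b' -> b = b'.
Proof.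
move=> /incrP[H1 H2] /incrP[H1' H2']; apply/ffunP => j; apply: val_inj => /=.
have [->|ji] := eqVneq j i; first by rewrite H1.
by rewrite H2 // H2'.
Qed.

Lemma incr_mono i a b (z : 'I_n -> C) : incr i a b -> mono b z = z i * mono a z.
Proof.
move=> /incrP[H1 H2]; rewrite /mono (bigD1 i) //= [in RHS](bigD1 i) //= H1 exprS -mulrA.
by congr (_ * (_ * _)); apply: eq_bigr => j /H2 ->.
Qed.

Lemma incr_dmono i a b (z : 'I_n -> C) : incr i a b ->
  mono a z = z i ^+ (b i).-1 * \prod_(j < n | j != i) z j ^+ (b j : nat).
Proof.
move=> /incrP[H1 H2]; rewrite /mono (bigD1 i) //= H1 /=.
by congr (_ * _); apply: eq_bigr => j /H2 ->.
Qed.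

Lemma incr_mdeg i a b : incr i a b -> mdeg b = (mdeg a).+1.
Proof.
move=> /incrP[H1 H2]; rewrite /mdeg (bigD1 i) //= [in RHS](bigD1 i) //= H1 addSn.
by congr ((_ + _).+1); apply: eq_bigr => j /H2 ->.
Qed.

Lemma incr_pred i (b : Multi n d) : (0 < b i)%N -> exists a, incr i a b.
Proof.
move=> bi; have lt : ((b i).-1 < d)%N by apply: leq_ltn_trans (leq_pred _) (ltn_ord _).
exists [ffun j => if j == i then Ordinal lt else b j]; apply/incrP; split=> [|j ji].
  by rewrite ffunE eqxx /= prednK.
by rewrite ffunE (negbTE ji).
Qed.

Lemma incr_succ i (a : Multi n d) : ((a i).+1 < d)%N -> exists b, incr i a b.
Proof.
move=> lt; exists [ffun j => if j == i then Ordinal lt else a j]; apply/incrP; split=> [|j ji].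
  by rewrite ffunE eqxx.
by rewrite ffunE (negbTE ji).
Qed.

Lemma leq_mdeg (a : Multi n d) i : (a i <= mdeg a)%N.
Proof. by rewrite /mdeg (bigD1 i) //= leq_addr. Qed.

End Increments.

Section HomogeneousPart.
Variables (J : {set Multi n d}) (k : nat).
Hypotheses (k0 : (0 < k)%N) (kd : (k < d)%N).

Local Notation F := (flat (Jk J k)).
Local Notation supp := {a : Multi n d | a \in J}.
Local Notation fsupp := {a : Multi n d | a \in F}.

Definition hproj (x : supp -> C) : supp -> C := fun b : supp => if mdeg (val b) == k then x b else 0.

Lemma flatP a : reflect (exists b i, b \in Jk J k /\ incr i a b) (a \in F).
Proof.
rewrite inE; apply: (iffP exists_inP) => [[b bJ /existsP[i H]]|[b [i [bJ H]]]].
  by exists b, i.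
by exists b => //; apply/existsP; exists i.
Qed.

Lemma flat_mdeg a : a \in F -> (mdeg a).+1 = k.
Proof.
move=> /flatP[b [i [bJ /incr_mdeg <-]]].
by move: bJ; rewrite !inE => /andP[_ /eqP].
Qed.

(** Only a = b - e_i contributes, and it lies in the reduced set because b is in J(k). If b_i = 0
    there is no such a and both sides vanish. *)
Lemma incr_sum (b : Multi n d) i (h : Multi n d -> C) v : b \in Jk J k ->
  (forall a, incr i a b -> h a = v) ->
  \sum_(a : fsupp) (incr i (val a) b)%:R * ((b i : nat)%:R * h (val a)) = (b i : nat)%:R * v.
Proof.
move=> bJ hv; case: (posnP (b i)) => [->|/incr_pred [a0 a0b]].
  by rewrite mul0r big1 // => a _; rewrite mul0r mulr0.
have a0F : a0 \in F by apply/flatP; exists b, i.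
rewrite (bigD1 (exist (fun a => a \in F) a0 a0F)) //= a0b mul1r (hv _ a0b) big1 ?addr0 // => a.
apply: contraNeq; rewrite -val_eqE /=; case E : (incr i (val a) b); last by rewrite mul0r eqxx.
by rewrite (incr_injl E a0b).
Qed.

(** The three factors come from the derivative estimate at the net points, from truncating to J(k),
    and from recovering a polynomial over [F] out of its values on the net. *)
Lemma hproj_unc_fact (lam : R) : projconst (PJnorm N F) < lam ->
  unc_fact (PJnorm N J) (PJnorm N J) hproj
    (expR 1 * Qnorm N (Lam n d k) (Jk J k) * lam).
Proof.
move=> lamP; have d0 : (0 < d)%N by exact: leq_ltn_trans kd.
have hF := PJnorm_seminorm F; have cF := PJnorm_coercive F d0.
have hJ := PJnorm_seminorm J.
have [M M0 HM] := @mono_bounded R n d N latN.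
have [||||m [zs [P [zs1 PE Pb]]]] := @projconst_net R fsupp (PJnorm N F) hF cF _
  [set z | N z <= 1] (fun z a => mono (val a) z) M lam _ _ _ _ lamP.
- by exists (fun _ => 0); rewrite /= (seminorm0 hN) ler01.
- by move=> z z1 a; exact: HM.
- by move=> x z z1; under eq_bigr do rewrite mulrC; exact: cabs_le_PJnorm.
- move=> x s H; apply: PJnorm_le => z z1; under eq_bigr do rewrite mulrC; exact: H.
have kC : k%:R != 0 :> C by rewrite pnatr_eq0 -lt0n.
pose dm (b : supp) i z : C := if mdeg (val b) == k then dmono i (val b) z else 0.
pose A (ji : 'I_m * 'I_n) (b : supp) : C := k%:R^-1 * dm b ji.2 (zs ji.1).
pose B (b : supp) (ji : 'I_m * 'I_n) : C := if mdeg (val b) == k then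
  \sum_(a : fsupp) (incr ji.2 (val a) (val b))%:R * P a ji.1 else 0.
(* [full g] is the k-homogeneous polynomial [sum_i z_i P (g (., i)) (z)]. *)
pose full (g : 'I_m * 'I_n -> C) (b : Multi n d) : C :=
  \sum_i \sum_(a : fsupp) (incr i (val a) b)%:R * app P (fun j => g (j, i)) a.
have BE g (b : supp) : app B g b = if mdeg (val b) == k then full g (val b) else 0.
  rewrite /app /B; case: ifP => _; last by rewrite big1 // => ji _; rewrite mul0r.
  transitivity (\sum_j \sum_i (\sum_(a : fsupp) (incr i (val a) (val b))%:R * P a j) * g (j, i)).
    by rewrite pair_bigA; apply: eq_bigr => -[j i] _.
  rewrite exchange_big /=; apply: eq_bigr => i _.
  under eq_bigr do rewrite mulr_suml.
  rewrite exchange_big /=; apply: eq_bigr => a _; rewrite /app mulr_sumr.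
  by apply: eq_bigr => j _; rewrite mulrA.
have inJk (b : supp) : mdeg (val b) == k -> val b \in Jk J k by rewrite !inE (valP b).
exists (('I_m * 'I_n)%type : finType), A, B; split=> [x b|t t1 x].
  rewrite BE /hproj; case: ifP => // bk; rewrite /full.
  (* Coefficients of (1/k) d_i of the k-homogeneous part; they are supported in [F], so [P] recovers
     them exactly from the net values. *)
  pose y i (a : fsupp) : C := k%:R^-1 * \sum_(b' : supp)
    (if mdeg (val b') == k then (incr i (val a) (val b'))%:R * (val b' i : nat)%:R * x b' else 0).
  have Py i a : app P (fun j => app A x (j, i)) a = y i a.
    rewrite -(PE (y i)); congr app; apply/funext => j.
    rewrite /app /A /= /y; under [LHS]eq_bigr do rewrite -mulrA.
    rewrite -mulr_sumr; under [RHS]eq_bigr do rewrite mulrCA mulr_sumr.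
    rewrite -mulr_sumr; congr (_ * _); rewrite exchange_big /=; apply: eq_bigr => b' _.
    rewrite /dm; case: ifP => b'k; last first.
      by rewrite mul0r big1 // => a' _; rewrite mulr0.
    rewrite /dmono -(incr_sum (h := fun a => mono a (zs j)) (inJk _ b'k)).
      by rewrite mulr_suml; apply: eq_bigr => a' _; ring.
    by move=> a' /incr_dmono ->.
  (* Euler's identity at the level of coefficients: the entries of b add up to k. *)
  transitivity (k%:R^-1 * (\sum_i (val b i : nat)%:R) * x b); last first.
    by rewrite -natr_sum -/(mdeg (val b)) (eqP bk) mulVf // mul1r.
  rewrite mulr_sumr mulr_suml; apply: eq_bigr => i _.
  rewrite -[(val b i : nat)%:R]mulr1.
  rewrite -(incr_sum (h := fun _ => 1) (i := i) (inJk _ bk)) // mulr_sumr mulr_suml.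
  apply: eq_bigr => a _; rewrite Py /y; case E : (incr _ _ _); last by rewrite !mul0r mulr0 mul0r.
  rewrite (bigD1 b) //= bk E big1 ?addr0; first by rewrite !mul1r mulr1 mulrA.
  move=> b' b'b; case: ifP => // _; case E' : (incr _ _ _); last by rewrite !mul0r.
  by case/eqP: b'b; apply: val_inj; exact: incr_injr E' E.
pose g ji := t ji * app A x ji; set s := expR 1 * PJnorm N J x.
have lam0 : 0 < lam by apply: le_lt_trans lamP; exact: projconst_ge0.
have s0 : 0 <= s by rewrite mulr_ge0 ?expR_ge0 ?seminorm_ge0.
(* After a change of signs the result may leave J but remains k-homogeneous, so the truncation costs
   exactly the [Qnorm] from [Lam n d k]. *)
have fullL b : b \notin Lam n d k -> full g b = 0.
  move=> bk; rewrite /full big1 // => i _; rewrite big1 // => a _.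
  case E : (incr _ _ _); last by rewrite mul0r.
  by move: bk; rewrite inE (incr_mdeg E) flat_mdeg ?eqxx // (valP a).
have -> : PJnorm N J (app B g) = polynorm N (fun b => if b \in Jk J k then full g b else 0).
  rewrite PJnormE (ext_eq (c := fun b => if mdeg b == k then full g b else 0) (BE g)).
  congr polynorm; apply/funext => b; rewrite !inE.
  by case: (b \in J).
apply: le_trans (Qnorm_bound _ d0 fullL) _.
have Q0 : 0 <= Qnorm N (Lam n d k) (Jk J k).
  by apply: sup_ge0 => _ [c _ <-]; apply: seminorm_ge0; exact: polynorm_seminorm.
have -> : expR 1 * Qnorm N (Lam n d k) (Jk J k) * lam * PJnorm N J x
    = Qnorm N (Lam n d k) (Jk J k) * (lam * s) by rewrite /s; ring.
rewrite ler_wpM2l //; apply: polynorm_le => // z z1.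
(* For fixed z the sum over i moves inside [P]; the bound [Pb] then needs only |G j| at each net
   point. *)
pose G j := \sum_i z i * g (j, i).
have -> : peval (full g) z = \sum_(a : fsupp) app P G a * mono (val a) z.
  have PG a : app P G a = \sum_i z i * app P (fun j => g (j, i)) a.
    rewrite /app /G; under eq_bigr do rewrite mulr_sumr.
    rewrite exchange_big /=; apply: eq_bigr => i _; rewrite mulr_sumr.
    by apply: eq_bigr => j _; rewrite mulrCA.
  under [RHS]eq_bigr do rewrite PG mulr_suml.
  rewrite /peval /full; under [LHS]eq_bigr do rewrite mulr_suml.
  rewrite exchange_big [RHS]exchange_big /=; apply: eq_bigr => i _.
  under [LHS]eq_bigr do rewrite mulr_suml.
  rewrite exchange_big /=; apply: eq_bigr => a _.
  (* There is room for a + e_i: the order of a is k - 1 and k < d. *)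
  have [b ab] : exists b, incr i (val a) b.
    apply: incr_succ; apply: leq_ltn_trans kd; have H := leq_mdeg (val a) i.
    by apply: leq_ltn_trans H _; have := flat_mdeg (valP a) => /eq_leq.
  rewrite (bigD1 b) //= ab mul1r (incr_mono _ ab) big1 ?addr0; first by ring.
  move=> b' b'b; case E : (incr _ _ _); last by rewrite !mul0r.
  by rewrite (incr_injr E ab) eqxx in b'b.
apply: le_trans (cabs_le_PJnorm _ z1) _; apply: Pb => // j.
(* The signs are absorbed into the direction: w has the moduli of z, and [G j] is 1/k times the
   derivative at [zs j] along w. *)
pose w i := z i * t (j, i).
have w1 : N w <= 1.
  apply: le_trans z1; have [_ mono_N] := latN; apply: mono_N => i.
  by rewrite cabsM t1 mulr1.
have -> : G j = k%:R^-1 * \sum_i w i * \sum_a hpart k (ext x) a * dmono i a (zs j).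
  rewrite /G mulr_sumr; apply: eq_bigr => i _; rewrite /g /w /app /A /=.
  under eq_bigr do rewrite -mulrA; rewrite -mulr_sumr.
  have -> : \sum_a hpart k (ext x) a * dmono i a (zs j) = \sum_(b : supp) dm b i (zs j) * x b.
    transitivity (\sum_a \sum_(b : supp) (val b == a)%:R * (dm b i (zs j) * x b)).
      apply: eq_bigr => a _; rewrite /hpart /ext /app; case: ifPn => ak.
        rewrite mulr_suml; apply: eq_bigr => b _; case: eqP => [ba|_]; last by rewrite !mul0r.
        by rewrite /dm ba ak !mul1r mulrC.
      rewrite mul0r big1 // => b _; case: eqP => [ba|_]; last by rewrite mul0r.
      by rewrite /dm ba (negbTE ak) mul0r mulr0.
    rewrite exchange_big /=; apply: eq_bigr => b _.
    rewrite (bigD1 (val b)) //= eqxx mul1r big1 ?addr0 // => a ab.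
    by rewrite eq_sym (negbTE ab) mul0r.
  by ring.
have k1 : 0 < k%:R :> R by rewrite ltr0n.
rewrite cabsM cabsV cabs_nat ler_pdivrMl //.
apply: le_trans (derivative_bound latN k0 _ (zs1 j) w1) _.
  by move=> a /negbTE ak; rewrite /hpart ak.
rewrite -mulrA ler_wpM2l ?(ltW k1) // /s ler_wpM2l ?expR_ge0 // PJnormE.
exact: polynorm_hpart.
Qed.

End HomogeneousPart.
End PolynomialSpaces.

(** * Gordon-Lewis constants of polynomial spaces *)

Section GordonLewisPolynomials.
Variables (R : realType) (n d : nat).
Local Notation C := R[i].
Local Open Scope complex_scope.
Variable N : ('I_n -> C) -> R.
Hypothesis latN : banach_lattice N.

Lemma Qnorm_ge0 (L J : {set Multi n d}) : 0 <= Qnorm N L J.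
Proof.
by apply: sup_ge0 => _ [c _ <-]; apply: seminorm_ge0; exact: polynorm_seminorm.
Qed.

(** Taking all signs equal to 1 at a fixed vector of [T]. It allows the cost 1 of the constant term
    to be replaced by the common bound. *)
Lemma unc_fact_ge1 (I : finType) (p : (I -> C) -> R) T (c : R) x :
  unc_fact p p T c -> T x = x -> 0 < p x -> 1 <= c.
Proof.
move=> [K [A [B [BA /(_ (fun _ => 1) (fun _ => cabs1 _) x) H]]]] Tx px.
rewrite -(ler_pM2r px) mul1r; apply: le_trans H.
rewrite -[in leLHS]Tx (_ : T x = app B (fun k => 1 * app A x k)) //.
by apply/funext => i; rewrite -BA; congr (app B _ i); apply/funext => k; rewrite mul1r.
Qed.

Variable J : {set Multi n d}.
Local Notation supp := {a : Multi n d | a \in J}.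

Lemma PJnorm_hproj k x : PJnorm N J (hproj k x) <= PJnorm N J x.
Proof.
rewrite !PJnormE (_ : ext (hproj k x) = hpart k (ext x)); first exact: polynorm_hpart.
rewrite (ext_eq (c := hpart k (ext x))) => [|b]; last by rewrite /hpart ext_val.
apply/funext => a; case: ifPn => // aJ.
by rewrite /hpart ext_out //; case: ifP.
Qed.

(** At most one multi-index has order 0, so a choice of signs multiplies the constant term by one
    unimodular scalar. *)
Lemma hproj0_unc_fact : unc_fact (PJnorm N J) (PJnorm N J) (hproj 0) 1.
Proof.
have hJ := PJnorm_seminorm latN J.
pose A (b' b : supp) : C := if mdeg (val b') == 0 then delta b b' else 0.
pose B (b b' : supp) : C := delta b b'.
have AE x : app A x = hproj 0 x.
  apply/funext => b; rewrite /app /A /hproj.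
  case: ifP => _; last by rewrite big1 // => i _; rewrite mul0r.
  by rewrite [RHS](delta_sum x b); apply: eq_bigr => i _; rewrite mulrC.
have BE y b : app B y b = y b.
  by rewrite [RHS](delta_sum y b); apply: eq_bigr => i _; rewrite mulrC /B /delta eq_sym.
exists supp, A, B; split=> [x i|t t1 x]; first by rewrite BE AE.
have uniq0 (b b' : supp) : mdeg (val b) == 0 -> mdeg (val b') == 0 -> b = b'.
  move=> /eqP b0 /eqP b'0; apply/val_inj/ffunP => i; apply/val_inj => /=.
  have := leq_mdeg (val b) i; have := leq_mdeg (val b') i.
  by rewrite b0 b'0 !leqn0 => /eqP -> /eqP ->.
have [s s1 sE] : exists2 s, cabs s = 1 & app B (fun k => t k * app A x k) = fun b => s * hproj 0 x b.
  have [b b0|H] := pickP (fun b : supp => mdeg (val b) == 0).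
    exists (t b) => //; apply/funext => b'; rewrite BE AE /hproj.
    by case: ifP => [b'0|]; rewrite ?mulr0 // (uniq0 b b').
  exists 1; first exact: cabs1.
  by apply/funext => b'; rewrite BE AE /hproj H !mulr0.
by rewrite sE (seminormZ hJ) s1 mul1r mul1r PJnorm_hproj.
Qed.

Lemma hproj_sum m (x : supp -> C) b : (forall a, a \in J -> (mdeg a <= m)%N) ->
  \sum_(k < m.+1) hproj k x b = x b.
Proof.
move=> Jm; have bm : (mdeg (val b) < m.+1)%N by rewrite ltnS Jm // (valP b).
rewrite (bigD1 (Ordinal bm)) //= big1 ?addr0 => [|k]; first by rewrite /hproj eqxx.
by rewrite -val_eqE /hproj eq_sym /= => /negbTE ->.
Qed.

End GordonLewisPolynomials.

Theorem theorem2p6 (R : realType) (n m : nat) (N : ('I_n -> R[i]) -> R) :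
  (1 <= m)%N -> banach_lattice N ->
  (forall J : {set Multi n m.+1}, J \subset Lam n m.+1 m ->
     glconst (PJnorm N J)
       <= expR 1 * Qnorm N (Lam n m.+1 m) J * projconst (PJnorm N (flat J)))
  /\
  (forall J : {set Multi n m.+1}, has_degree J m ->
     glconst (PJnorm N J)
       <= expR 1 * (m.+1)%:R
          * \big[Num.max/0]_(1 <= k < m.+1) Qnorm N (Lam n m.+1 k) (Jk J k)
          * \big[Num.max/0]_(1 <= k < m.+1) projconst (PJnorm N (flat (Jk J k)))).
Proof.
move=> m1 latN; split=> J.
  move=> Jm; have JkJ : Jk J m = J by apply/finset.setIidPl.
  have Q0 := Qnorm_ge0 latN (Lam n m.+1 m) J.
  have hJ := PJnorm_seminorm latN J.
  apply: le_mul_of_gt => [|l ltl]; first by rewrite mulr_ge0 ?expR_ge0.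
  have l0 : 0 <= l by apply: le_trans (ltW ltl); exact/projconst_ge0/PJnorm_seminorm.
  apply: (glconst_le hJ (PJnorm_coercive latN J isT)); first by rewrite !mulr_ge0 ?expR_ge0.
  have := @hproj_unc_fact R n m.+1 N latN J m m1 (ltnSn m) l; rewrite JkJ => /(_ ltl) H.
  apply: (unc_fact_le (seminorm_ge0 hJ) H) => // x b.
  (* All of J has order m, so the m-homogeneous part is the identity. *)
  by rewrite /hproj; have := fintype.subsetP Jm _ (valP b); rewrite inE => ->.
move=> [Jm [a0 a0J a0m]]; have hJ := PJnorm_seminorm latN J.
have cJ := PJnorm_coercive latN J (isT : (0 < m.+1)%N).
set Q := \big[Num.max/0]_(_ <= _ < _) _; set P := \big[Num.max/0]_(_ <= _ < _) _.
have Q0 : 0 <= Q by exact: bigmax_ge_id.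
have P0 : 0 <= P by exact: bigmax_ge_id.
apply: le_mul_of_gt => [|l ltl]; first by rewrite !mulr_ge0 ?expR_ge0.
have l0 : 0 <= l by apply: le_trans (ltW ltl).
pose c := expR 1 * Q * l.
have Hk k : (1 <= k)%N -> (k < m.+1)%N -> unc_fact (PJnorm N J) (PJnorm N J) (hproj k) c.
  move=> k1 km; have kin : k \in index_iota 1 m.+1 by rewrite mem_index_iota k1.
  have Pk : projconst (PJnorm N (flat (Jk J k))) < l.
    apply: le_lt_trans ltl.
    exact: (le_bigmax_seq 0 k xpredT (fun k => projconst (PJnorm N (flat (Jk J k)))) kin isT).
  apply: (unc_fact_le (seminorm_ge0 hJ) (hproj_unc_fact latN k1 km Pk)) => //.
  rewrite /c ler_wpM2r // ler_wpM2l ?expR_ge0 //.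
  exact: (le_bigmax_seq 0 k xpredT (fun k => Qnorm N (Lam n m.+1 k) (Jk J k)) kin isT).
(* The monomial of maximal order m in J is fixed by [hproj m] and has nonzero norm. *)
have c1 : 1 <= c.
  pose b0 : {a : Multi n m.+1 | a \in J} := exist (fun a => a \in J) a0 a0J.
  apply: (unc_fact_ge1 (x := delta b0) (Hk m m1 (ltnSn m))).
    apply/funext => b; rewrite /hproj /delta; case: eqP => // bm.
    by case: eqP => // bb0; case: bm; rewrite bb0.
  have [K K0 HK] := cJ; rewrite lt_def seminorm_ge0 // andbT.
  apply/eqP => z; have := HK (delta b0) b0.
  by rewrite z mulr0 /delta eqxx cabs1 ler10.
(* The factor m + 1 counts the homogeneous parts of orders 0 to m, each of cost at most c. *)
have -> : expR 1 * m.+1%:R * Q * l = \sum_(k < m.+1) c.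
  by rewrite sumr_const card_ord -mulr_natl /c; ring.
apply: (glconst_le hJ cJ); first by rewrite sumr_ge0 // => k _; exact: le_trans c1.
apply: (unc_fact_le (seminorm_ge0 hJ) (unc_fact_sum (c := fun _ => c)
  (T := fun k => @hproj R n m.+1 J k) hJ hJ _)) => //.
- move=> [_|k km]; last exact: Hk.
  exact: (unc_fact_le (seminorm_ge0 hJ) (hproj0_unc_fact latN J)).
- by move=> x b; rewrite hproj_sum.
Qed.
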